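(* We have the generating function $$\tilde C_n^{CFC}(q)=A_{n+1}^{CFC}(q)+\frac{2^n}{1-q^{n+1}}\,q^{2(n+1)}+\frac{2n}{1-q^{2n}}\,q^{2n}.$$ The coefficients of $\tilde C_n^{CFC}(q)$ are ultimately periodic of exact period $n(n+1)$ if $n$ is odd, and $2n(n+1)$ if $n$ is even. Moreover, the periodicity starts at length $n$.
   Context: $\tilde C_n$ (with $n\ge 2$) is the affine Coxeter group with generators $t,s_1,\dots,s_{n-1},u$ whose Coxeter diagram is the path $t-s_1-\cdots-s_{n-1}-u$, with $m_{ts_1}=m_{s_{n-1}u}=4$ and $m=3$ on all other edges. $A_m$ is the finite Coxeter group with $m$ generators whose diagram is a path with all edges $m=3$. For a Coxeter group $W$ with length $\ell$, an element is fully commutative (FC) if any two of its reduced expressions are related by a sequence of transpositions of adjacent commuting generators. A cyclic shift of a word $s_{i_1}\cdots s_{i_k}$ is any word $s_{i_j}\cdots s_{i_k}s_{i_1}\cdots s_{i_{j-1}}$. An element is cyclically fully commutative (CFC) if every cyclic shift of every one of its reduced expressions is a reduced expression of an FC element. $W^{CFC}$ is the set of CFC elements, and $W^{CFC}(q)=\sum_{w\in W^{CFC}}q^{\ell(w)}$ (a formal power series). A sequence $(a_k)_{k\ge0}$ is ultimately periodic of exact period $N$ with periodicity starting at length $L$ if $a_{k+N}=a_k$ for all $k\ge L$, $N$ is the least positive integer that is an eventual period, and $L$ is the least integer with this property.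
   Formalization: The periodicity is stated to start at length n+1 instead of n: with L the least integer such that a_{k+N}=a_k for all k≥L, length n fails for every n≥2, since a_n>0 but a_{n+N}=0 (for n=2, N=12: a_2=5, a_14=0). *)

(* Defs.v *)
From HB Require Import structures.
From mathcomp Require Import all_boot all_order all_algebra.
From mathcomp Require Import finmap.
From mathcomp Require Import boolp classical_sets functions cardinality.

Set Implicit Arguments.
Unset Strict Implicit.
Unset Printing Implicit Defensive.

Import GRing.Theory.

Local Open Scope nat_scope.
Local Open Scope quotient_scope.

(* The value 0 stands for m_st = infinity. *)
Record coxMatrix (S : finType) := CoxMatrix {
  cox_m :> S -> S -> nat;
  cox_diag : forall s, cox_m s s = 1;
  cox_sym : forall s t, cox_m s t = cox_m t s;
  cox_offdiag : forall s t, s != t -> cox_m s t != 1 }.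

Section CoxeterGroup.
Variables (S : finType) (m : coxMatrix S).

(* The congruence on words generated by (st)^m_st = 1.  The case s = t reads
   s^2 = 1, so this monoid presentation already presents the group; when
   m_st = 0 the relation is void, as it should be for infinity. *)
Inductive cox_cong : seq S -> seq S -> Prop :=
| cox_refl u : cox_cong u u
| cox_symm u v : cox_cong u v -> cox_cong v u
| cox_trans u v w : cox_cong u v -> cox_cong v w -> cox_cong u w
| cox_rel u v s t :
    cox_cong (u ++ flatten (nseq (m s t) [:: s; t]) ++ v) (u ++ v).

Definition cox_congb (u v : seq S) : bool := `[< cox_cong u v >].

Lemma cox_congb_refl : reflexive cox_congb.
Proof. by move=> u; apply/asboolP; exact: cox_refl. Qed.

Lemma cox_congb_sym : symmetric cox_congb.
Proof. by move=> u v; apply/asboolP/asboolP; exact: cox_symm. Qed.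

Lemma cox_congb_trans : transitive cox_congb.
Proof.
by move=> v u w /asboolP uv /asboolP vw; apply/asboolP; exact: cox_trans uv vw.
Qed.

Canonical cox_equiv :=
  EquivRel cox_congb cox_congb_refl cox_congb_sym cox_congb_trans.

Definition coxGroup := {eq_quot cox_equiv}.
HB.instance Definition _ := Choice.on coxGroup.
HB.instance Definition _ := EqQuotient.on coxGroup.

Lemma cox_piP (u v : seq S) :
  \pi_coxGroup u = \pi_coxGroup v <-> cox_cong u v.
Proof.
by split=> [/eqquotP/asboolP|uv]; [|apply/eqquotP/asboolP].
Qed.

Lemma cox_cong_catl w u v : cox_cong u v -> cox_cong (w ++ u) (w ++ v).
Proof.
elim=> {u v} [u|u v _|u v x _ uv _|u v s t]; first exact: cox_refl.
- exact: cox_symm.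
- exact: cox_trans.
- by rewrite !(catA w); exact: cox_rel.
Qed.

Lemma cox_cong_catr w u v : cox_cong u v -> cox_cong (u ++ w) (v ++ w).
Proof.
elim=> {u v} [u|u v _|u v x _ uv _|u v s t]; first exact: cox_refl.
- exact: cox_symm.
- exact: cox_trans.
- by rewrite -!catA; exact: cox_rel.
Qed.

Lemma cox_cong_cat u u' v v' :
  cox_cong u u' -> cox_cong v v' -> cox_cong (u ++ v) (u' ++ v').
Proof.
by move=> uu vv; apply: cox_trans (cox_cong_catr _ uu) (cox_cong_catl _ vv).
Qed.

Lemma cox_cong_rev_rel s t k :
  cox_cong (rev (flatten (nseq k [:: s; t]))) (flatten (nseq k [:: t; s])).
Proof.
elim: k => [|k IH] /=; first exact: cox_refl.
rewrite !rev_cons -!cats1 -catA /= -[[:: t, s & _]]/([:: t; s] ++ _).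
have -> : [:: t, s & flatten (nseq k [:: t; s])]
    = flatten (nseq k [:: t; s]) ++ [:: t; s].
  by elim: k {IH} => //= k {1}->.
exact: cox_cong_catr.
Qed.

Lemma cox_cong_rev u v : cox_cong u v -> cox_cong (rev u) (rev v).
Proof.
elim=> {u v} [u|u v _|u v x _ uv _|u v s t]; first exact: cox_refl.
- exact: cox_symm.
- exact: cox_trans.
rewrite !rev_cat -catA.
apply: cox_cong_catl; rewrite -[X in cox_cong _ X]cat0s.
apply: cox_cong_catr; apply: cox_trans (cox_cong_rev_rel _ _ _) _.
by rewrite cox_sym -[X in cox_cong X _]cats0; exact: (cox_rel [::] [::]).
Qed.

Lemma cox_cong_cat_rev u : cox_cong (u ++ rev u) [::].
Proof.
elim: u => [|s u IH]; first exact: cox_refl.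
rewrite rev_cons -cats1 cat_cons catA -cat1s.
apply: (@cox_trans _ ([:: s] ++ [::] ++ [:: s])).
  by apply: cox_cong_catl; apply: cox_cong_catr.
by have := cox_rel [::] [::] s s; rewrite cox_diag.
Qed.

Definition cox_mul (x y : coxGroup) : coxGroup :=
  \pi_coxGroup (repr x ++ repr y).
Definition cox_inv (x : coxGroup) : coxGroup := \pi_coxGroup (rev (repr x)).
Definition cox_one : coxGroup := \pi_coxGroup [::].

Lemma cox_repr_pi u : cox_cong (repr (\pi_coxGroup u)) u.
Proof. by apply/cox_piP; rewrite reprK. Qed.

Lemma cox_mul_pi u v :
  cox_mul (\pi_coxGroup u) (\pi_coxGroup v) = \pi_coxGroup (u ++ v).
Proof. by apply/cox_piP; apply: cox_cong_cat; exact: cox_repr_pi. Qed.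

Lemma cox_inv_pi u : cox_inv (\pi_coxGroup u) = \pi_coxGroup (rev u).
Proof. by apply/cox_piP/cox_cong_rev; exact: cox_repr_pi. Qed.

Lemma cox_piW (P : coxGroup -> Prop) :
  (forall u, P (\pi_coxGroup u)) -> forall x, P x.
Proof. by move=> Ppi x; rewrite -[x]reprK. Qed.

Lemma cox_mulA : associative cox_mul.
Proof.
elim/cox_piW=> u; elim/cox_piW=> v; elim/cox_piW=> w.
by rewrite !cox_mul_pi catA.
Qed.

Lemma cox_1mul : left_id cox_one cox_mul.
Proof. by elim/cox_piW=> u; rewrite cox_mul_pi. Qed.

Lemma cox_mul1 : right_id cox_one cox_mul.
Proof. by elim/cox_piW=> u; rewrite cox_mul_pi cats0. Qed.

Lemma cox_mulV : right_inverse cox_one cox_inv cox_mul.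
Proof.
elim/cox_piW=> u; rewrite cox_inv_pi cox_mul_pi.
exact/cox_piP/cox_cong_cat_rev.
Qed.

Lemma cox_Vmul : left_inverse cox_one cox_inv cox_mul.
Proof.
elim/cox_piW=> u; rewrite cox_inv_pi cox_mul_pi; apply/cox_piP.
by rewrite -[X in _ ++ X]revK; exact: cox_cong_cat_rev.
Qed.

HB.instance Definition _ :=
  isGroup.Build coxGroup cox_mulA cox_1mul cox_mul1 cox_Vmul cox_mulV.

Definition cox_gen (s : S) : coxGroup := \pi_coxGroup [:: s].

Definition cox_word (e : seq S) : coxGroup := (\prod_(s <- e) cox_gen s)%g.

Lemma cox_wordE e : cox_word e = \pi_coxGroup e.
Proof.
rewrite /cox_word; elim: e => [|s e IH]; first by rewrite big_nil.
by rewrite big_cons IH; exact: cox_mul_pi.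
Qed.

Lemma cox_word_surj (w : coxGroup) : exists e, cox_word e = w.
Proof. by exists (repr w); rewrite cox_wordE reprK. Qed.

Lemma cox_length_ex (w : coxGroup) :
  exists k, `[< exists e, cox_word e = w /\ size e = k >].
Proof.
by have [e ew] := cox_word_surj w; exists (size e); apply/asboolP; exists e.
Qed.

Definition cox_length (w : coxGroup) : nat := ex_minn (cox_length_ex w).

Definition reduced_expr (w : coxGroup) (e : seq S) : Prop :=
  cox_word e = w /\ size e = cox_length w.

(* s and t are taken to commute when m_st = 2. *)
Inductive commutation_equiv : seq S -> seq S -> Prop :=
| comm_refl e : commutation_equiv e e
| comm_step u v s t e : m s t = 2 ->
    commutation_equiv (u ++ [:: t; s] ++ v) e ->
    commutation_equiv (u ++ [:: s; t] ++ v) e.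

Definition is_FC (w : coxGroup) : Prop :=
  forall e e', reduced_expr w e -> reduced_expr w e' -> commutation_equiv e e'.

Definition is_CFC (w : coxGroup) : Prop :=
  forall e, reduced_expr w e -> forall j,
    exists w', is_FC w' /\ reduced_expr w' (rot j e).

Definition CFC_of_length (k : nat) : set coxGroup :=
  [set w | is_CFC w /\ cox_length w = k].

Lemma finite_CFC_of_length k : finite_set (CFC_of_length k).
Proof.
apply: (@sub_finite_set _ _ [set cox_word (val t) | t in [set: k.-tuple S]]).
  move=> w [_ wk] /=; move: wk; rewrite /cox_length.
  case: ex_minnP => l /asboolP [e [ew <-]] _ ek.
  by exists (tcast ek (in_tuple e)) => //; rewrite val_tcast.
by apply: finite_image; exact: finite_finset.
Qed.

End CoxeterGroup.

Arguments CFC_of_length {S} m k.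

(* Generator i is joined to i + 1 by an edge labelled [lab i]. *)
Section PathDiagram.
Variables (r : nat) (lab : nat -> nat).
Hypothesis lab_neq1 : forall i, lab i != 1.

Definition path_m (i j : 'I_r) : nat :=
  if i == j then 1
  else if i.+1 == j :> nat then lab i
  else if j.+1 == i :> nat then lab j
  else 2.

Lemma path_m_diag i : path_m i i = 1.
Proof. by rewrite /path_m eqxx. Qed.

Lemma path_m_sym i j : path_m i j = path_m j i.
Proof.
rewrite /path_m eq_sym; case: ifP => // _.
case: (i.+1 =P j :> nat) => [ij|//]; case: (j.+1 =P i :> nat) => [ji|//].
by move: (leqnn i); rewrite -{1}ji -ij ltnNge leqnSn.
Qed.

Lemma path_m_offdiag i j : i != j -> path_m i j != 1.
Proof.
by rewrite /path_m => /negPf ->; case: ifP => // _; case: ifP.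
Qed.

Definition path_coxMatrix : coxMatrix 'I_r :=
  CoxMatrix path_m_diag path_m_sym path_m_offdiag.

End PathDiagram.

Lemma A_lab_neq1 (i : nat) : 3 != 1.
Proof. by []. Qed.

Definition A_matrix (r : nat) : coxMatrix 'I_r :=
  @path_coxMatrix r (fun=> 3) A_lab_neq1.

(* The generators t, s_1, ..., s_(n-1), u are numbered 0, 1, ..., n-1, n. *)
Definition Ctilde_lab (n i : nat) : nat :=
  if (i == 0) || (i == n.-1) then 4 else 3.

Lemma Ctilde_lab_neq1 n i : Ctilde_lab n i != 1.
Proof. by rewrite /Ctilde_lab; case: ifP. Qed.

Definition Ctilde_matrix (n : nat) : coxMatrix 'I_n.+1 :=
  @path_coxMatrix n.+1 (Ctilde_lab n) (Ctilde_lab_neq1 n).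

Record fps (R : Type) := Fps { fcoef : nat -> R }.

HB.instance Definition _ (R : Type) := gen_eqMixin (fps R).
HB.instance Definition _ (R : Type) := gen_choiceMixin (fps R).

Lemma fpsP (R : Type) (f g : fps R) : fcoef f =1 fcoef g -> f = g.
Proof. by case: f g => [f] [g] /= /funext ->. Qed.

Local Open Scope ring_scope.

Section FpsRing.
Variable R : comNzRingType.
Implicit Types f g h : fps R.

Definition fps_const (c : R) : fps R := Fps (fun k => if k == 0%N then c else 0).
Definition fps_X : fps R := Fps (fun k => (k == 1%N)%:R).
Definition fps_zero : fps R := Fps (fun=> 0).
Definition fps_opp f : fps R := Fps (fun k => - fcoef f k).
Definition fps_add f g : fps R := Fps (fun k => fcoef f k + fcoef g k).
Definition fps_mul f g : fps R :=
  Fps (fun k => \sum_(i < k.+1) fcoef f i * fcoef g (k - i)%N).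

Lemma fps_addA : associative fps_add.
Proof. by move=> f g h; apply: fpsP => k /=; rewrite addrA. Qed.
Lemma fps_addC : commutative fps_add.
Proof. by move=> f g; apply: fpsP => k /=; rewrite addrC. Qed.
Lemma fps_add0 : left_id fps_zero fps_add.
Proof. by move=> f; apply: fpsP => k /=; rewrite add0r. Qed.
Lemma fps_addN : left_inverse fps_zero fps_opp fps_add.
Proof. by move=> f; apply: fpsP => k /=; rewrite addNr. Qed.

HB.instance Definition _ :=
  GRing.isZmodule.Build (fps R) fps_addA fps_addC fps_add0 fps_addN.

Definition fps_trunc (n : nat) f : {poly R} := \poly_(i < n) fcoef f i.

Lemma coef_fps_trunc_mul n f g k : (k < n)%N ->
  (fps_trunc n f * fps_trunc n g)`_k = fcoef (fps_mul f g) k.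
Proof.
move=> kn; rewrite coefM /=; apply: eq_bigr => i _.
rewrite !coef_poly (leq_ltn_trans (leq_subr _ _) kn).
by rewrite (leq_ltn_trans _ kn) // -ltnS.
Qed.

Lemma fps_mulC : commutative fps_mul.
Proof.
move=> f g; apply: fpsP => k.
by rewrite -!(@coef_fps_trunc_mul k.+1) // mulrC.
Qed.

Lemma fps_mulA : associative fps_mul.
Proof.
move=> f g h; apply: fpsP => k.
pose T := fps_trunc k.+1.
transitivity ((T f * (T g * T h))`_k).
  rewrite coefM /=; apply: eq_bigr => i _.
  by rewrite coef_poly ltn_ord coef_fps_trunc_mul // ltnS leq_subr.
rewrite mulrA coefM /=; apply: eq_bigr => i _.
by rewrite coef_fps_trunc_mul ?ltn_ord // coef_poly ltnS leq_subr.
Qed.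

Lemma fps_mul1 : left_id (fps_const 1) fps_mul.
Proof.
move=> f; apply: fpsP => k /=.
rewrite big_ord_recl /= subn0 mul1r big1 ?addr0 // => i _.
by rewrite mul0r.
Qed.

Lemma fps_mulDl : left_distributive fps_mul fps_add.
Proof.
move=> f g h; apply: fpsP => k /=; rewrite -big_split /=.
by apply: eq_bigr => i _; rewrite mulrDl.
Qed.

Lemma fps_1neq0 : fps_const 1 != 0 :> fps R.
Proof.
apply/eqP => /(congr1 (fun f : fps R => fcoef f 0)) /= /eqP.
by rewrite (negbTE (oner_neq0 R)).
Qed.

HB.instance Definition _ := GRing.Zmodule_isComNzRing.Build (fps R)
  fps_mulA fps_mulC fps_mul1 fps_mulDl fps_1neq0.

End FpsRing.

Section FpsUnit.
Variable R : comUnitRingType.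
Implicit Types f g : fps R.

Definition fps_unit : {pred fps R} := [pred f | fcoef f 0 \is a GRing.unit].

(* The list g_0, ..., g_k determined by f_0 g_0 = 1 and
   f_0 g_k = - \sum_(1 <= i <= k) f_i g_(k-i). *)
Fixpoint fps_inv_seq f (k : nat) : seq R :=
  if k is k'.+1 then
    let s := fps_inv_seq f k' in
    rcons s (- (fcoef f 0)^-1 * \sum_(i < k'.+1) fcoef f i.+1 * s`_(k' - i))
  else [:: (fcoef f 0)^-1].

Definition fps_inv f : fps R :=
  if f \in fps_unit then Fps (fun k => (fps_inv_seq f k)`_k) else f.

Lemma size_fps_inv_seq f k : size (fps_inv_seq f k) = k.+1.
Proof. by elim: k => //= k IH; rewrite size_rcons IH. Qed.

Lemma nth_fps_inv_seq f k i : (i <= k)%N ->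
  (fps_inv_seq f k)`_i = (fps_inv_seq f i)`_i.
Proof.
elim: k => [|k IH]; first by rewrite leqn0 => /eqP ->.
rewrite leq_eqVlt => /orP [/eqP -> //|]; rewrite ltnS => ik /=.
by rewrite nth_rcons size_fps_inv_seq ltnS ik IH.
Qed.

Lemma fps_mulVx : {in fps_unit, left_inverse 1 fps_inv *%R}.
Proof.
move=> f fU; rewrite mulrC; apply: fpsP => k.
have f0U : fcoef f 0 \is a GRing.unit by [].
rewrite /fps_inv fU [LHS]/=; case: k => [|k].
  by rewrite big_ord_recl big_ord0 addr0 /= mulrV.
rewrite big_ord_recl subn0 /= nth_rcons size_fps_inv_seq ltnn eqxx.
rewrite mulrA mulrN mulrV // mulN1r addrC; apply/eqP; rewrite subr_eq0.
apply/eqP; apply: eq_bigr => i _.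
by rewrite subSS [in RHS]nth_fps_inv_seq // leq_subr.
Qed.

Lemma fps_unitPl f g : g * f = 1 -> fps_unit f.
Proof.
move=> /(congr1 (fun h : fps R => fcoef h 0)).
rewrite [LHS]/= [RHS]/= big_ord_recl big_ord0 addr0 subn0 => gf.
by apply/unitrP; exists (fcoef g 0); split; last rewrite mulrC.
Qed.

Lemma fps_inv_out : {in [predC fps_unit], fps_inv =1 id}.
Proof. by move=> f; rewrite inE /fps_inv => /negbTE ->. Qed.

HB.instance Definition _ := GRing.ComNzRing_hasMulInverse.Build (fps R)
  fps_mulVx fps_unitPl fps_inv_out.

End FpsUnit.

Notation "{ 'fps' R }" := (fps R) (at level 0, format "{ 'fps'  R }").
Notation "''q'" := (fps_X int) (at level 0) : ring_scope.

Definition CFC_series (S : finType) (m : coxMatrix S) : {fps int} :=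
  Fps (fun k => (#|` fset_set (CFC_of_length m k)|)%:Z).

Definition periodic_from (T : Type) (a : nat -> T) (N L : nat) : Prop :=
  forall k, (L <= k)%N -> a (k + N)%N = a k.

Definition eventual_period (T : Type) (a : nat -> T) (N : nat) : Prop :=
  (0 < N)%N /\ exists L, periodic_from a N L.

Definition exactly_ult_periodic (T : Type) (a : nat -> T) (N : nat) : Prop :=
  eventual_period a N /\ forall M, eventual_period a M -> (N <= M)%N.

(* L is the first index from which periodicity holds, so it is one more than
   the last exceptional index.  For the type C~_n series the last exceptional
   index is n: the coefficient of q^n is (n + 3) 2^(n - 2), contributed by
   A_(n+1), whereas the coefficient of q^(n + N) vanishes for every period N.
   Hence the value of L is n + 1; "starts at length n" is only correct if it
   is read as "holds for all lengths k > n". *)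
Definition periodicity_starts_at (T : Type) (a : nat -> T) (N L : nat) : Prop :=
  periodic_from a N L /\ forall L', periodic_from a N L' -> (L <= L')%N.

(* Main.v *)
Require Import Defs.
From mathcomp Require Import all_boot all_order all_algebra.
From mathcomp Require Import zify ring.
From mathcomp Require Import finmap boolp classical_sets functions cardinality.

Set Implicit Arguments.
Unset Strict Implicit.
Unset Printing Implicit Defensive.

Local Open Scope nat_scope.

(** A CFC element is a commutation class of words, and the theorem amounts to
    listing these classes.

    The first ingredient is Stembridge's criterion: a word is a reduced
    expression of an FC element if and only if no word of its commutation class
    has a factor [ss] or a long braid ([avoids_is_FC], [FC_avoids]). The hard
    direction goes through the parity of the number of times a word crosses a
    given wall, which depends on the group element only; this gives the exchange
    property, hence a dihedral prefix as soon as an element has two descents.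
    That argument needs the product of two generators to have exactly the
    prescribed order, which is checked on an integral reflection
    representation ([cartan_exact]).

    Consequently all rotations of the words of a CFC element satisfy local
    conditions on the gap separating two cyclically consecutive occurrences of a
    letter [i]: it contains at least two neighbours of [i], or only one if the
    edge between them is labelled 4; and next to an end of the path two
    consecutive gaps cannot realize a braid of length 4. Summing these conditions
    over all gaps gives inequalities between the multiplicities of neighbouring
    letters. In type [A] they are contradictory unless each letter occurs at most
    once ([Acyc_uniq]). In type [C~] they say that, if some letter is repeated, the
    largest multiplicity is reached at the letter 1, and that all inequalities
    are equalities ([max_at_1], [first_gap_dichotomy]). Two patterns remain
    ([Ccyc_classification]): either any two neighbouring letters alternate
    cyclically, or the word is a rotation of a power of the zigzag
    [1 0 1 2 ... n ... 2].

    Conversely these words are CFC, because each family is stable under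
    commutations and rotations and has no forbidden factor ([CFC_of_stable]).
    A commutation class is determined by the words read in the pairs of
    neighbouring letters ([projectionsP]), which makes the counting easy: the
    words without repetition give the same classes in types [A] and [C~]; an
    alternating class with multiplicity [p] amounts to choosing, for each of the
    [n] edges, which letter comes first; and the zigzags of a given length are
    the [2n] rotations of one word.

    Finally, at lengths beyond [n] the coefficient is
    [2^n [n+1 | k] + 2n [2n | k]], because the words without repetition of length
    [n + 1] are exactly the alternating ones of multiplicity 1. Its maximal value
    is attained at the common multiples of [n + 1] and [2n] only, which fixes the
    period. *)

(** * Words, walls and full commutativity *)

Fixpoint alt (T : Type) (s t : T) k : seq T :=
  if k is k'.+1 then s :: alt t s k' else [::].

Lemma size_alt (T : Type) (s t : T) k : size (alt s t k) = k.
Proof. by elim: k s t => //= k IH s t; rewrite IH. Qed.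

Lemma flatten_alt (T : Type) (s t : T) k :
  flatten (nseq k [:: s; t]) = alt s t k.*2.
Proof. by elim: k => //= k ->. Qed.

Lemma rev_alt (T : Type) (s t : T) k :
  rev (alt s t k) = if odd k then alt s t k else alt t s k.
Proof.
have rcons_alt (a b : T) j :
    rcons (alt a b j) (if odd j then b else a) = alt a b j.+1.
  elim: j a b => //= j IH a b; rewrite -IH.
  by case: (odd j).
elim: k s t => //= k IH s t; rewrite rev_cons IH.
by case: ifP => ok /=; rewrite -[RHS]rcons_alt ok.
Qed.

Lemma alt_cat (T : Type) (s t : T) k l :
  alt s t (k + l) = alt s t k ++ (if odd k then alt t s l else alt s t l).
Proof.
elim: k s t => //= k IH s t; rewrite IH.
by case: (odd k).
Qed.

Section Words.
Variables (S : finType) (m : coxMatrix S).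
Implicit Types (s t : S) (e u v : seq S) (x w : coxGroup m).

Local Notation gen := (cox_gen m).
Local Notation word := (cox_word m).
Local Notation ceq := (commutation_equiv m).

Lemma word_eqP u v : word u = word v <-> cox_cong m u v.
Proof. by rewrite !cox_wordE; exact: cox_piP. Qed.

Lemma word_nil : word [::] = 1%g.
Proof. by rewrite /cox_word big_nil. Qed.

Lemma word_cons s e : word (s :: e) = (gen s * word e)%g.
Proof. by rewrite /cox_word big_cons. Qed.

Lemma word_cat u v : word (u ++ v) = (word u * word v)%g.
Proof. by rewrite /cox_word big_cat. Qed.

Lemma word_rev e : word (rev e) = ((word e)^-1)%g.
Proof. by rewrite !cox_wordE -cox_inv_pi. Qed.

Lemma genK s : (gen s * gen s)%g = 1%g.
Proof.
have /word_eqP := cox_rel m [::] [::] s s.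
by rewrite cox_diag /= !word_cons word_nil mulg1.
Qed.

Lemma genV s : ((gen s)^-1)%g = gen s.
Proof. by apply: mulg1_eq; exact: genK. Qed.

Lemma genKl s x : (gen s * (gen s * x))%g = x.
Proof. by rewrite mulgA genK mul1g. Qed.

Lemma word_alt_double s t k : word (alt s t k.*2) = ((gen s * gen t) ^+ k)%g.
Proof.
elim: k => [|k IH]; first by rewrite word_nil expg0.
by rewrite /= !word_cons IH expgS mulgA.
Qed.

Lemma gen_rel s t : ((gen s * gen t) ^+ m s t = 1)%g.
Proof.
have /word_eqP := cox_rel m [::] [::] s t.
by rewrite cats0 flatten_alt word_alt_double word_nil.
Qed.

(** Both sides are halves of the relator, one of them inverted. *)
Lemma word_braid s t : word (alt s t (m s t)) = word (alt t s (m s t)).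
Proof.
have := gen_rel s t; rewrite -word_alt_double -addnn alt_cat word_cat.
move/mulg1_eq/(congr1 (fun x => x^-1)%g); rewrite invgK => ->.
by rewrite -word_rev; case: ifP => om; rewrite rev_alt om.
Qed.

Lemma word_comm s t : m s t = 2 -> (gen s * gen t = gen t * gen s)%g.
Proof.
move=> mst; have := word_braid s t; rewrite mst /= !word_cons word_nil.
by rewrite !mulg1.
Qed.

(** How invariants of group elements are obtained below: the parity of the
    length, the parity of the crossings, and the action on a representation. *)
Lemma word_invariant (T : Type) (f : seq S -> T) :
    (forall u v s t, f (u ++ alt s t (m s t).*2 ++ v) = f (u ++ v)) ->
  forall u v, word u = word v -> f u = f v.
Proof.
move=> f_rel u v /word_eqP; elim=> {u v} // [u v x _ -> _ -> //|u v s t].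
by rewrite flatten_alt f_rel.
Qed.

Lemma word_parity u v : word u = word v -> odd (size u) = odd (size v).
Proof.
move: u v; apply: word_invariant => u v s t.
by rewrite !size_cat !oddD size_alt odd_double.
Qed.

Definition reduced e := forall e', word e' = word e -> size e <= size e'.

Lemma reduced_exprP w e : reduced_expr w e <-> word e = w /\ reduced e.
Proof.
rewrite /reduced_expr /cox_length /reduced.
case: ex_minnP => k /asboolP[f [fw <-]] min_f; split=> -[ew se]; split=> //.
- by move=> e' e'e; rewrite se; apply: min_f; apply/asboolP; exists e'; rewrite e'e.
- apply/eqP; rewrite eqn_leq se ?fw ?ew //; apply: min_f.
  by apply/asboolP; exists e.
Qed.

Lemma reduced_ex w : exists e, word e = w /\ reduced e.
Proof.
suff: exists e, reduced_expr w e by case=> e /reduced_exprP; exists e.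
rewrite /reduced_expr /cox_length; case: ex_minnP => k' /asboolP[e [ew ek]] _.
by exists e.
Qed.

Lemma reduced_eq_size e f : reduced e -> word e = word f ->
  size f = size e -> reduced f.
Proof. by move=> re ef sz g gf; rewrite sz; apply: re; rewrite gf ef. Qed.

Lemma reduced_behead s e : reduced (s :: e) -> reduced e.
Proof.
move=> re e' e'e; have := re (s :: e'); rewrite !word_cons e'e /=.
by apply.
Qed.

Lemma commute_step_word s t u v : m s t = 2 ->
  word (u ++ [:: s; t] ++ v) = word (u ++ [:: t; s] ++ v).
Proof.
by move=> mst; rewrite !word_cat !word_cons word_nil !mulg1 word_comm.
Qed.

Lemma ceq_trans e f g : ceq e f -> ceq f g -> ceq e g.
Proof. by elim=> // u v s t h mst _ IH hg; apply: comm_step mst (IH hg). Qed.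

Lemma ceq_swap s t u v : m s t = 2 ->
  ceq (u ++ [:: s; t] ++ v) (u ++ [:: t; s] ++ v).
Proof. by move=> mst; apply: (comm_step mst); exact: comm_refl. Qed.

Lemma ceq_sym e f : ceq e f -> ceq f e.
Proof.
elim=> [g|u v s t g mst _ IH]; first exact: comm_refl.
by apply: ceq_trans IH (ceq_swap _ _ _); rewrite cox_sym.
Qed.

Lemma ceq_catl u e f : ceq e f -> ceq (u ++ e) (u ++ f).
Proof.
elim=> [g|u' v s t g mst _ IH]; first exact: comm_refl.
by rewrite catA; apply: (comm_step mst); rewrite -catA.
Qed.

Lemma ceq_cons s e f : ceq e f -> ceq (s :: e) (s :: f).
Proof. exact: (@ceq_catl [:: s]). Qed.

Lemma ceq_word e f : ceq e f -> word e = word f.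
Proof. by elim=> // u v s t g mst _ <-; exact: commute_step_word. Qed.

Lemma ceq_perm e f : ceq e f -> perm_eq e f.
Proof.
elim=> // u v s t g mst _; apply: perm_trans.
by rewrite perm_cat2l perm_cat2r -[[:: s; t]]/([:: s] ++ [:: t]) perm_catC.
Qed.

Lemma ceq_size e f : ceq e f -> size e = size f.
Proof. by move/ceq_perm/perm_size. Qed.

(** Swapping two commuting letters cannot be seen by a set of letters that do not
    commute with one another. *)
Lemma ceq_filter (a : pred S) e f :
    (forall s t, a s -> a t -> s != t -> m s t != 2) ->
  ceq e f -> filter a e = filter a f.
Proof.
move=> a_nc; elim=> // u v s t g mst _ <-; rewrite !filter_cat /=.
have [->//|st] := eqVneq s t.
case: ifP => // as_; case: ifP => // at_.
by have := a_nc s t as_ at_ st; rewrite mst.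
Qed.

Lemma ceq_move s u v :
  (forall t, t \in u -> m s t = 2) -> ceq (s :: u ++ v) (u ++ s :: v).
Proof.
elim: u => [|t u IH] hu; first exact: comm_refl.
apply: (@ceq_trans _ (t :: s :: u ++ v)).
  by apply: (@ceq_swap s t [::]); apply: hu; rewrite mem_head.
by apply: ceq_cons; apply: IH => r ru; apply: hu; rewrite inE ru orbT.
Qed.

(** A word is a gallery in the Coxeter complex; these are the reflections in the
    walls it crosses, from the first to the last. *)
Fixpoint crossings e : seq (coxGroup m) :=
  if e is s :: e' then
    gen s :: [seq gen s * x * gen s | x <- crossings e']%g
  else [::].

Lemma crossings_cat u v : crossings (u ++ v) =
  crossings u ++ [seq word u * x * (word u)^-1 | x <- crossings v]%g.
Proof.
elim: u => [|s u IH] /=.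
  rewrite -[LHS]map_id; apply: eq_map => x.
  by rewrite word_nil invg1 mulg1 mul1g.
rewrite IH map_cat -map_comp; congr (_ :: _ ++ _); apply: eq_map => x /=.
by rewrite word_cons invgM genV !mulgA.
Qed.

Lemma gen_expgSl s t i :
  (gen s * (gen t * gen s) ^+ i * gen t)%g = ((gen s * gen t) ^+ i.+1)%g.
Proof.
elim: i => [|i IH]; first by rewrite expg0 mulg1 expg1.
by rewrite [in RHS]expgS -IH [in LHS]expgS !mulgA.
Qed.

Lemma crossings_alt s t k :
  crossings (alt s t k) = mkseq (fun i => (gen s * gen t) ^+ i * gen s)%g k.
Proof.
elim: k s t => //= k IH s t; rewrite IH /mkseq /= expg0 mul1g.
congr (_ :: _); rewrite -map_comp -[1]/(1 + 0) iotaDl -map_comp.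
by apply: eq_map => i /=; rewrite -[in RHS]gen_expgSl !mulgA.
Qed.

(** A relator crosses each of its walls twice, because [i |-> (st)^i s] has
    period [m s t]; so the parity of the number of crossings of a given wall
    depends on the group element only. *)
Lemma crossings_parity x u v : word u = word v ->
  odd (count_mem x (crossings u)) = odd (count_mem x (crossings v)).
Proof.
move: u v; apply: word_invariant => u v s t.
have relator y : ~~ odd (count_mem y (crossings (alt s t (m s t).*2))).
  rewrite crossings_alt -addnn /mkseq iotaD map_cat count_cat.
  rewrite add0n.
  rewrite [X in _ + count _ X](_ : _ =
      [seq (gen s * gen t) ^+ i * gen s | i <- iota 0 (m s t)]%g).
    by rewrite addnn odd_double.
  rewrite -[X in iota X _](addn0 (m s t)) iotaDl -map_comp.
  by apply: eq_map => i /=; rewrite expgnDr gen_rel mul1g.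
have relator1 : word (alt s t (m s t).*2) = 1%g.
  by rewrite word_alt_double gen_rel.
have conj1 (c : seq (coxGroup m)) : [seq 1 * y * 1^-1 | y <- c]%g = c.
  by rewrite -[RHS]map_id; apply: eq_map => y; rewrite invg1 mulg1 mul1g.
rewrite !crossings_cat relator1 conj1 !map_cat !count_cat !oddD.
congr (_ (+) _).
rewrite -[RHS]addFb; congr (_ (+) _); apply/negbTE.
rewrite count_map (eq_count (_ : _ =1 pred1 ((word u)^-1 * x * word u)%g)) //.
move=> y /=; apply/eqP/eqP => [<-|->]; first by rewrite !mulgA mulVg mul1g mulgVK.
by rewrite !mulgA mulgV mul1g mulgK.
Qed.

(** The exchange property: reflecting the end of a gallery in one of the walls
    that it crosses folds the gallery, which saves a letter. *)
Lemma crossing_deletion x e : x \in crossings e ->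
  exists e', (x * word e)%g = word e' /\ (size e').+1 = size e.
Proof.
elim: e x => //= s e IH x; rewrite inE => /orP[/eqP ->|/mapP[y ye ->]].
  by exists e; rewrite word_cons genKl.
have [e' [ye' se']] := IH y ye; exists (s :: e'); rewrite /= se'; split=> //.
by rewrite !word_cons -ye' -!mulgA genKl.
Qed.

(** A reduced word crosses the wall of its first letter once, hence every word
    for the same element crosses it at least once. *)
Lemma descent_crossing t f e : reduced (t :: f) -> word e = word (t :: f) ->
  gen t \in crossings e.
Proof.
move=> rtf /(crossings_parity (gen t)) /=; rewrite eqxx.
rewrite -has_pred1 has_count; case: (count _ (crossings e)) => //=.
rewrite (count_memPn _) //; apply/negP => /mapP[x xf tx].
have xt : x = gen t.
  by move/(congr1 (fun y => gen t * y * gen t)%g): tx; rewrite !mulgA !genK !mul1g -mulgA genK mulg1.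
have [f' [ff' sf']] := crossing_deletion xf.
have := rtf f'; rewrite -ff' xt word_cons /= => /(_ erefl).
by rewrite -sf' ltnNge leqnSn.
Qed.

(** With [gen_rel], this says that [st] has order exactly [m s t], infinite order
    being encoded by 0 in both [coxMatrix] and divisibility. *)
Definition cox_exact :=
  forall s t j, ((gen s * gen t) ^+ j = 1)%g -> m s t %| j.

Section Exact.
Hypothesis exact_m : cox_exact.

(** If two generators [s], [t] are both left descents, the exchange property
    lets one prepend them alternately: the deleted letter never lies in the
    alternating prefix as long as that prefix is shorter than the order of
    [st]. *)
Lemma dihedral_prefix s t f g k : k <= m s t \/ m s t = 0 ->
    reduced (s :: f) -> reduced (t :: g) -> word (s :: f) = word (t :: g) ->
  exists b, word (alt s t k ++ b) = word (s :: f) /\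
            size (alt s t k ++ b) = size (s :: f).
Proof.
elim: k s t f g => [|k IH] s t f g km rf rg fg; first by exists (s :: f).
have [|b [wb sb]] := IH t s g f _ rg rf (esym fg).
  by rewrite cox_sym; case: km; [left; exact: ltnW | right].
have := descent_crossing rf (etrans wb (esym fg)).
rewrite crossings_cat mem_cat crossings_alt => /orP[/mapP[i]|/mapP[x xb sx]].
  rewrite mem_iota add0n => ik /(congr1 (fun y => y * gen s)%g).
  rewrite genK -mulgA -expgSr => /esym/exact_m; rewrite cox_sym.
  case: km => [km|->]; last by rewrite dvd0n.
  by move=> /(dvdn_leq (ltn0Sn _)); rewrite leqNgt (leq_trans _ km).
have [b' [bb' sb']] := crossing_deletion xb; exists b'.
have size_fg : size (t :: g) = size (s :: f).
  by apply/eqP; rewrite eqn_leq rf ?rg.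
split; last by rewrite -size_fg -sb !size_cat !size_alt -sb' addSnnS.
rewrite /= word_cons word_cat -bb'.
apply: (mulgI (gen s)); rewrite genKl fg -wb word_cat.
by rewrite sx !mulgA mulgVK.
Qed.

(** No word of the commutation class of [e] has a factor [ss] or a long braid:
    the combinatorial face of full commutativity. *)
Definition avoids e := forall e', ceq e e' ->
  (forall u s v, e' <> u ++ [:: s; s] ++ v) /\
  (forall u s t v, 3 <= m s t -> e' <> u ++ alt s t (m s t) ++ v).

Lemma avoids_ceq e f : ceq e f -> avoids e -> avoids f.
Proof. by move=> ef ae g fg; apply: ae; exact: ceq_trans ef fg. Qed.

Lemma avoids_behead s e : avoids (s :: e) -> avoids e.
Proof.
move=> ae e' ee'; have [no_sq no_br] := ae _ (ceq_cons s ee').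
split=> [u r v ev|u r t v mrt ev].
- by apply: (no_sq (s :: u) r v); rewrite ev.
- by apply: (no_br (s :: u) r t v mrt); rewrite ev.
Qed.

(** Induction on the length. If [s g] were not reduced, [g] would be equivalent
    to a word beginning with [s], giving a factor [ss]. If [t f] is another
    reduced word for the same element, both [s] and [t] are descents, so the
    class contains a dihedral prefix, which has to be a mere commutation. *)
Lemma avoids_reduced_FC e : avoids e ->
  reduced e /\ forall f, reduced f -> word f = word e -> ceq e f.
Proof.
have [k] := ubnP (size e).
elim: k e => // k IH [|s g] sz ae.
  split=> [//|f rf /= fe]; have := rf [::] (esym fe).
  by rewrite leqn0 => /nilP ->; exact: comm_refl.
have ag := avoids_behead ae; have [rg FCg] := IH g sz ag.
have re : reduced (s :: g).
  have [h [hw rh]] := reduced_ex (word (s :: g)).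
  (* otherwise [g] and [s h] are reduced words for the same element *)
  move=> f fe; apply: (@leq_trans (size h)); last by apply: rh; rewrite hw.
  rewrite leqNgt; apply/negP => /=; rewrite ltnS => hg.
  have hsg : word (s :: h) = word g by rewrite word_cons hw word_cons genKl.
  have hlt : size h < size g.
    rewrite ltn_neqAle hg andbT; apply: contra_eqN (word_parity hsg) => /eqP /= ->.
    by case: (odd _).
  have rsh : reduced (s :: h).
    by move=> h' h'h; apply: leq_trans hlt (rg _ _); rewrite h'h hsg.
  have [no_sq _] := ae _ (ceq_cons s (FCg _ rsh hsg)).
  exact: (no_sq [::] s h).
split=> // [] [|t f] rf fe.
  by have := re [::] fe.
have [ts|ts] := eqVneq t s.
  rewrite ts in rf fe *; apply: ceq_cons; apply: FCg (reduced_behead rf) _.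
  by move: fe; rewrite !word_cons; exact: mulgI.
(* an infinite bond would provide dihedral prefixes longer than the word *)
have fin : m s t != 0.
  apply/negP => /eqP m0.
  have [|b [_]] := dihedral_prefix (k := (size (s :: g)).+1) _ re rf (esym fe).
    by right.
  by rewrite size_cat size_alt => /eqP; rewrite addSn eqn_leq ltnNge leq_addr.
have [|b [wb sb]] := dihedral_prefix (k := m s t) _ re rf (esym fe).
  by left.
have [mst [k' mk]] : 2 <= m s t /\ exists k', m s t = k'.+1.
  have := cox_offdiag m (s := s) (t := t); rewrite eq_sym ts => /(_ isT).
  by move: fin; case: (m s t) => [|[|k']] // _ _; split=> //; exists k'.+1.
have ga : ceq g (alt t s k' ++ b).
  move: wb sb; rewrite mk /= !word_cons => /mulgI wb [sb].
  by apply: FCg => //; exact: reduced_eq_size rg (esym wb) sb.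
have [m2|m3] := eqVneq (m s t) 2; last first.
  have [_ /(_ [::] s t b)] := ae _ (ceq_cons s ga).
  by rewrite mk /= => /(_ _ erefl) []; rewrite -mk ltn_neqAle eq_sym m3.
have etsb : ceq (s :: g) (t :: s :: b).
  apply: ceq_trans (ceq_cons s ga) _.
  have -> : k' = 1 by apply/eqP; rewrite -eqSS -mk m2.
  exact: (@ceq_swap s t [::] b m2).
apply: (ceq_trans etsb); apply: ceq_cons.
have ssz : size (s :: b) < k.
  by have /= [<-] := ceq_size etsb.
have [_] := IH (s :: b) ssz (avoids_behead (avoids_ceq etsb ae)).
apply; first exact: reduced_behead rf.
apply: (mulgI (gen t)); rewrite -!word_cons fe.
exact: ceq_word etsb.
Qed.

Lemma avoids_is_FC e : avoids e -> reduced_expr (word e) e /\ is_FC (word e).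
Proof.
move=> /avoids_reduced_FC[re FCe]; split; first exact/reduced_exprP.
move=> f g /reduced_exprP[fe rf] /reduced_exprP[ge rg].
exact: ceq_trans (ceq_sym (FCe f rf fe)) (FCe g rg ge).
Qed.

End Exact.

(** A long braid can be replaced by the other one without changing the length,
    but not by commutations, since these preserve the word read in the two
    letters of the braid. *)
Lemma FC_avoids e : reduced_expr (word e) e -> is_FC (word e) -> avoids e.
Proof.
move=> /reduced_exprP[_ re] FCe e' ee'.
have re' := reduced_eq_size re (ceq_word ee') (esym (ceq_size ee')).
split=> [u s v ev|u s t v mst ev].
  have := re' (u ++ v); rewrite ev !word_cat !word_cons word_nil mulg1 genK mul1g.
  by move=> /(_ erefl); rewrite !size_cat /= -addSnnS -addSnnS; lia.
set f := u ++ alt t s (m s t) ++ v.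
have fe' : word f = word e' by rewrite ev !word_cat word_braid.
have sf : size f = size e' by rewrite ev !size_cat !size_alt.
have we' : word e' = word e by rewrite (ceq_word ee').
have e'f : ceq e' f.
  apply: FCe; apply/reduced_exprP; split; rewrite ?fe' ?we' //.
  exact: reduced_eq_size re' (esym fe') sf.
have st : s != t by apply: contraTneq mst => ->; rewrite cox_diag.
have a_nc a b : pred2 s t a -> pred2 s t b -> a != b -> m a b != 2.
  move=> /pred2P[]-> /pred2P[]->; rewrite ?eqxx // => _;
    by rewrite ?[m t s]cox_sym; apply: contraTneq mst => ->.
have alt_all a b k : {subset [:: a; b] <= pred2 s t} ->
    filter (pred2 s t) (alt a b k) = alt a b k.
  elim: k a b => //= k IH a b sub.
  have := sub a (mem_head _ _); rewrite !inE /= => ->; rewrite IH // => c cb.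
  apply: sub.
  by rewrite !inE orbC in cb *.
have /eqP := ceq_filter a_nc e'f.
rewrite ev !filter_cat eqseq_cat // eqxx eqseq_cat; last first.
  by rewrite !alt_all ?size_alt // => c; rewrite !inE // orbC.
rewrite !alt_all; try by move=> c; rewrite !inE // orbC.
by case: (m s t) mst => //= k _; rewrite eqseq_cons (negPf st).
Qed.

End Words.

(** * Orders of the products of two generators *)

Section Crystallographic.
Import GRing.Theory.
Local Open Scope ring_scope.
Variables (S : finType) (m : coxMatrix S) (a : S -> S -> int).

(** The opposites of the off-diagonal entries of a generalized Cartan matrix
    with only simple and double bonds. Being integral it avoids the square roots
    of the symmetric form. *)
Definition cartan_bonds := forall s t, s != t ->
  [\/ [/\ m s t = 2%N, a s t = 0 & a t s = 0],
      [/\ m s t = 3%N, a s t = 1 & a t s = 1],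
      [/\ m s t = 4%N, a s t = 1 & a t s = 2]
    | [/\ m s t = 4%N, a s t = 2 & a t s = 1]].
Hypothesis bonds : cartan_bonds.

Implicit Types x : S -> int.

Definition reflection s x : S -> int :=
  fun k => if k == s then - x s + \sum_(j | j != s) a s j * x j else x k.

(** The reflections in [s] and [t] only change these two coordinates, so their
    products can be computed on [set2 s t x p q], where [x] is fixed. *)
Definition set2 s t x p q : S -> int :=
  fun k => if k == s then p else if k == t then q else x k.

Lemma set2_id s t x : x = set2 s t x (x s) (x t).
Proof.
by apply/funext => k; rewrite /set2; case: eqP => [->|_] //; case: eqP => [->|].
Qed.

Lemma set2C s t x p q : s != t -> set2 s t x p q = set2 t s x q p.
Proof.
move=> st; apply/funext => k; rewrite /set2.
by have [->|//] := eqVneq k s; rewrite (negPf st).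
Qed.

Definition others s t x : int := \sum_(j | (j != s) && (j != t)) a s j * x j.

Lemma reflection_set2l s t x p q : s != t -> reflection s (set2 s t x p q) =
  set2 s t x (- p + a s t * q + others s t x) q.
Proof.
move=> st; apply/funext => k; rewrite /reflection /set2.
have ts : t != s by rewrite eq_sym.
have [_|//] := eqVneq k s; rewrite !eqxx (bigD1 t) //= (negPf ts).
rewrite eqxx addrA; congr (_ + _); apply: eq_bigr => j /andP[js jt].
by rewrite (negPf js) (negPf jt).
Qed.

Lemma reflection_set2r s t x p q : s != t -> reflection t (set2 s t x p q) =
  set2 s t x p (- q + a t s * p + others t s x).
Proof.
move=> st; have ts : t != s by rewrite eq_sym.
by rewrite set2C // reflection_set2l // set2C.
Qed.

Lemma reflectionK s x : reflection s (reflection s x) = x.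
Proof.
apply/funext => k; rewrite /reflection; case: eqP => // ->; rewrite eqxx.
rewrite opprD opprK -addrA -[RHS]addr0; congr (_ + _).
apply/eqP; rewrite addrC subr_eq0; apply/eqP; apply: eq_bigr => j js.
by rewrite (negPf js).
Qed.

Definition word_reflection e x := foldr reflection x e.

Lemma reflection_relator s t x : word_reflection (alt s t (m s t).*2) x = x.
Proof.
have [->|st] := eqVneq s t; first by rewrite cox_diag /= reflectionK.
rewrite [in RHS](set2_id s t x) [x in word_reflection _ x](set2_id s t x).
by case: (bonds st) => -[-> ast ats]; rewrite /= !(reflection_set2l, reflection_set2r) // ast ats;
  congr set2; ring.
Qed.

Lemma word_reflection_inv u v :
  cox_word m u = cox_word m v -> word_reflection u = word_reflection v.
Proof.
move: u v; apply: word_invariant => u v s t; apply/funext => x.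
by rewrite /word_reflection !foldr_cat -[foldr _ _ (alt _ _ _)]/(word_reflection _ _) reflection_relator.
Qed.

(** The reflections satisfy the Coxeter relations, and no smaller power of
    [st] fixes the vector with coordinate 1 in [t] and 0 elsewhere. *)
Lemma cartan_exact : cox_exact m.
Proof.
move=> s t j st1; have [->|st] := eqVneq s t; first by rewrite cox_diag dvd1n.
have m0 : (0 < m s t)%N by case: (bonds st) => -[->].
rewrite /dvdn; have := ltn_pmod j m0; set r := (j %% _)%N.
have {st1} : ((cox_gen m s * cox_gen m t) ^+ r = 1)%g.
  by rewrite -[RHS]st1 (divn_eq j (m s t)) expgnDr mulnC expgnA gen_rel expg1n mul1g.
rewrite -word_alt_double -(word_nil m) => /word_reflection_inv fix_r.
have := congr1 (fun f => f (set2 s t (fun=> 0) 0 1)) fix_r; clear fix_r.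
have o0 b c : others b c (fun=> 0) = 0.
  by rewrite /others big1 // => i _; rewrite mulr0.
move: r => [|r] //.
have neq p q p' q' : set2 s t (fun=> 0) p q = set2 s t (fun=> 0) p' q' -> p = p' /\ q = q'.
  move=> e; have := congr1 (fun f => f s) e; have := congr1 (fun f => f t) e.
  by rewrite /set2 !eqxx eq_sym (negPf st) => -> ->.
case: (bonds st) => -[-> ast ats];
  case: r => [|[|[|//]]] //=; rewrite !(reflection_set2l, reflection_set2r) // ast ats !o0 => /neq [] //.
Qed.

End Crystallographic.

Section PathExact.
Variables (r : nat) (lab : nat -> nat) (lab_neq1 : forall i, lab i != 1).
Hypothesis lab34 : forall i, lab i = 3 \/ lab i = 4.

(** A bond labelled 4 is given the weights 2 and 1, a bond labelled 3 the weights
    1 and 1. *)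
Lemma path_exact : cox_exact (@path_coxMatrix r lab lab_neq1).
Proof.
pose a (i j : 'I_r) : int :=
  if i.+1 == j :> nat then (if lab i == 3 then 1 else 2)%R
  else if j.+1 == i :> nat then 1%R else 0%R.
apply: (@cartan_exact _ _ a) => i j ij; rewrite /= /path_m /a (negPf ij).
case: (eqVneq i.+1 j) => [e|ne].
  rewrite [j.+1 == _](_ : _ = false); last by apply/negbTE; rewrite -e; lia.
  by case: (lab34 i) => ->; [apply: Or42|apply: Or44].
case: (eqVneq j.+1 i) => [e|ne'].
  by case: (lab34 j) => ->; [apply: Or42|apply: Or43].
exact: Or41.
Qed.

End PathExact.

(** * Gaps between equal letters *)

Section CyclicWords.
Variables (S : finType) (m : coxMatrix S).
Implicit Types (s t i j : S) (e u v x y : seq S) (w : coxGroup m).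
Local Notation ceq := (commutation_equiv m).

Lemma CFC_rot_avoids w e r :
  is_CFC w -> reduced_expr w e -> avoids m (rot r e).
Proof.
move=> cfc ew; have [w' [FCw' rw']] := cfc e ew r.
by case: (rw') => w'E _; apply: FC_avoids; rewrite w'E.
Qed.

(** By stability every word met while commuting and rotating stays in [K], hence
    satisfies the criterion for full commutativity. *)
Lemma CFC_of_stable (K : seq S -> Prop) : cox_exact m ->
    (forall e f, ceq e f -> K e -> K f) ->
    (forall r e, K e -> K (rot r e)) ->
    (forall u s v, ~ K (u ++ [:: s; s] ++ v)) ->
    (forall u s t v, 3 <= m s t -> ~ K (u ++ alt s t (m s t) ++ v)) ->
  forall e, K e ->
    [/\ avoids m e, reduced_expr (cox_word m e) e & is_CFC (cox_word m e)].
Proof.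
move=> exact_m K_ceq K_rot K_sq K_br.
have K_avoids e : K e -> avoids m e.
  move=> Ke f ef; have Kf := K_ceq _ _ ef Ke.
  split=> [u s v fE|u s t v mst fE]; first by apply: (K_sq u s v); rewrite -fE.
  by apply: (K_br u s t v mst); rewrite -fE.
move=> e Ke; have ae := K_avoids _ Ke; have [re FCe] := avoids_is_FC exact_m ae.
split=> // f rf r; exists (cox_word m (rot r f)).
have /K_avoids/(avoids_is_FC exact_m)[] // : K (rot r f).
by apply/K_rot/K_ceq/Ke; exact: FCe.
Qed.

Lemma ceq_moveL s u v : (forall t, t \in u -> m s t = 2) ->
  ceq (u ++ s :: v) (s :: u ++ v).
Proof. by move=> h; apply: ceq_sym; exact: ceq_move. Qed.

(** In the next four lemmas the letters that stand in the way commute with those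
    to be brought together, so that a forbidden factor appears. *)
Lemma avoids_gap u i x v :
  avoids m (u ++ i :: x ++ i :: v) -> has (fun j => m i j != 2) x.
Proof.
move=> av; apply/negPn/negP => /hasPn x2.
have /av[no_sq _] : ceq (u ++ i :: x ++ i :: v) (u ++ i :: i :: x ++ v).
  apply: ceq_catl; apply: ceq_cons; apply: ceq_moveL => j /x2.
  by rewrite negbK => /eqP.
exact: (no_sq u i (x ++ v)).
Qed.

Lemma avoids_gap3 u i x1 j x2 v :
    (forall k, k \in x1 -> m i k = 2) -> (forall k, k \in x2 -> m i k = 2) ->
  avoids m (u ++ i :: x1 ++ j :: x2 ++ i :: v) -> m i j <> 3.
Proof.
move=> h1 h2 av mij.
have /av[_] : ceq (u ++ i :: x1 ++ j :: x2 ++ i :: v)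
                  ((u ++ x1) ++ i :: j :: i :: x2 ++ v).
  rewrite -catA; apply: ceq_catl.
  apply: (ceq_trans (ceq_move _ h1)); apply: ceq_catl; do 2!apply: ceq_cons.
  exact: ceq_moveL.
by move=> /(_ (u ++ x1) i j (x2 ++ v)); rewrite mij => /(_ isT); apply.
Qed.

Lemma avoids_gap4 u j y i x1 x2 v :
    (forall k, k \in y -> m j k = 2) -> (forall k, k \in x1 -> m j k = 2) ->
    (forall k, k \in x1 -> m i k = 2) -> (forall k, k \in x2 -> m i k = 2) ->
  avoids m (u ++ j :: y ++ i :: x1 ++ j :: x2 ++ i :: v) -> m j i <> 4.
Proof.
move=> hy hx1 h1 h2 av mij.
have /av[_] : ceq (u ++ j :: y ++ i :: x1 ++ j :: x2 ++ i :: v)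
                  ((u ++ y) ++ j :: i :: j :: i :: x1 ++ x2 ++ v).
  rewrite -catA; apply: ceq_catl.
  apply: (ceq_trans (ceq_move _ hy)); apply: ceq_catl; do 2!apply: ceq_cons.
  apply: (ceq_trans (ceq_moveL _ hx1)); apply: ceq_cons.
  rewrite !catA; apply: ceq_moveL => k; rewrite mem_cat => /orP[]; [exact: h1|exact: h2].
by move=> /(_ (u ++ y) j i (x1 ++ x2 ++ v)); rewrite mij => /(_ isT); apply.
Qed.

Lemma avoids_gap4' u i x1 j x2 y v :
    (forall k, k \in y -> m j k = 2) -> (forall k, k \in x2 -> m j k = 2) ->
    (forall k, k \in x1 -> m i k = 2) -> (forall k, k \in x2 -> m i k = 2) ->
  avoids m (u ++ i :: x1 ++ j :: x2 ++ i :: y ++ j :: v) -> m i j <> 4.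
Proof.
move=> hy hx2 h1 h2 av mij.
have /av[_] : ceq (u ++ i :: x1 ++ j :: x2 ++ i :: y ++ j :: v)
                  ((u ++ x1) ++ i :: j :: i :: j :: x2 ++ y ++ v).
  rewrite -catA; apply: ceq_catl.
  apply: (ceq_trans (ceq_move _ h1)); apply: ceq_catl; do 2!apply: ceq_cons.
  apply: (ceq_trans (ceq_moveL _ h2)); apply: ceq_cons.
  rewrite !catA; apply: ceq_moveL => k; rewrite mem_cat => /orP[]; [exact: hx2|exact: hy].
by move=> /(_ (u ++ x1) i j (x2 ++ y ++ v)); rewrite mij => /(_ isT); apply.
Qed.

End CyclicWords.

Lemma map_cat_cons_inv (T1 T2 : Type) (f : T1 -> T2) s u y v :
    map f s = u ++ y :: v ->
  exists u' x v', [/\ s = u' ++ x :: v', u = map f u', y = f x & v = map f v'].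
Proof.
elim: u s => [|z u IH] [|x s] //= [zx suv].
  by exists [::], x, s; split.
have [u' [x' [v' [-> -> -> ->]]]] := IH s suv.
by exists (x :: u'), x', v'; split; rewrite // -zx.
Qed.

Lemma count1_split (T : eqType) (p : pred T) (x : seq T) :
  count p x = 1 ->
  exists x1 j x2, [/\ x = x1 ++ j :: x2, p j,
    forall k, k \in x1 -> ~~ p k & forall k, k \in x2 -> ~~ p k].
Proof.
elim: x => //= k x IH; have [pk|pk] := boolP (p k).
  rewrite add1n => -[/eqP]; rewrite -leqn0 leqNgt -has_count => /hasPn h.
  by exists [::], k, x; split.
rewrite add0n => /IH[x1 [j [x2 [-> pj h1 h2]]]]; exists (k :: x1), j, x2.
by split=> // l; rewrite inE => /predU1P[->//|/h1].
Qed.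

Definition adj (i k : nat) : bool := (k == i.+1) || (i == k.+1).

Definition nb i (x : seq nat) := count (adj i) x.

(** The three properties below are what the absence of [ii], [iji] and [jiji]
    says about the part [x] of a word lying between two occurrences of [i]. They
    are stated for words of natural numbers in order to count letters and to use
    the reversal [k |-> n - k] of the path. *)
Definition gap_nonempty (E : seq nat) := forall u i x v,
  E = u ++ i :: x ++ i :: v -> i \notin x -> 0 < nb i x.

(** Here [P i j] stands for the edges that are not labelled 3: a single neighbour
    [j] of [i] would make a braid [iji]. *)
Definition gap_simple (P : nat -> nat -> bool) (E : seq nat) :=
  forall u i x v, E = u ++ i :: x ++ i :: v -> i \notin x -> nb i x = 1 ->
  exists2 j, j \in x & adj i j && P i j.

(** For an end [j] of the path whose edge is labelled 4, this excludes [jiji] and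
    [ijij]: the letter [j] of the second gap can be moved within that gap since
    its only neighbour is [i]. *)
Definition gap_double j i (E : seq nat) :=
  (forall u y x v, E = u ++ j :: y ++ i :: x ++ i :: v ->
     i \notin y -> j \notin y -> i \notin x -> j \in x -> nb i x = 1 -> False) /\
  (forall u x y v, E = u ++ i :: x ++ i :: y ++ j :: v ->
     i \notin y -> j \notin y -> i \notin x -> j \in x -> nb i x = 1 -> False).

Section PathWords.
Variables (r : nat) (lab : nat -> nat) (lab_neq1 : forall i, lab i != 1).
Hypothesis lab34 : forall i, lab i = 3 \/ lab i = 4.
Local Notation M := (@path_coxMatrix r lab lab_neq1).
Implicit Types (i j k : 'I_r) (e : seq 'I_r).

Lemma path_adj i k : i != k -> (M i k != 2) = adj i k.
Proof.
move=> ik; rewrite /= /path_m /adj (negPf ik) [k == _ :> nat]eq_sym.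
rewrite [i == _ :> nat]eq_sym.
have [e|_] := eqVneq i.+1 (val k); first by case: (lab34 i) => ->.
by have [e|_] := eqVneq k.+1 (val i); [case: (lab34 k) => ->|].
Qed.

Lemma path_comm i k : i != k -> ~~ adj i k -> M i k = 2.
Proof. by move=> ik; rewrite -path_adj // negbK => /eqP. Qed.

Lemma avoids_gap_nonempty e : avoids M e -> gap_nonempty (map val e).
Proof.
move=> av u i x v w0; have [u' [i' [w [eE _ -> /esym wE]]]] := map_cat_cons_inv w0.
clear w0.
have [x' [i3 [v4 [w'E -> /val_inj i3E _]]]] := map_cat_cons_inv wE.
rewrite w'E -i3E in eE; clear wE.
rewrite eE in av; have /hasP[j jx mij] := avoids_gap av.
rewrite mem_map; last exact: val_inj.
move=> ix; rewrite /nb -has_count; apply/hasP; exists (val j).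
  exact: map_f.
rewrite -path_adj //; by apply: contraNneq ix => ->.
Qed.

Lemma avoids_gap_simple e : avoids M e ->
  gap_simple (fun i j : nat => (if i.+1 == j then lab i else lab j) == 4) (map val e).
Proof.
move=> av u i x v w0; have [u' [i' [w [eE _ -> /esym wE]]]] := map_cat_cons_inv w0.
clear w0.
have [x' [i3 [v4 [w'E -> /val_inj i3E _]]]] := map_cat_cons_inv wE.
rewrite w'E -i3E in eE; clear wE.
rewrite mem_map; last exact: val_inj.
move=> ix; rewrite /nb count_map => /count1_split[x1 [j [x2 [xE /= aj h1 h2]]]].
exists (val j); first by rewrite xE map_f // mem_cat mem_head orbT.
have ij : i' != j by apply: contraNneq ix => ->; rewrite xE mem_cat mem_head orbT.
have h k : k \in x1 ++ x2 -> M i' k = 2.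
  move=> kx; apply: path_comm.
    by apply: contraNneq ix => ->; rewrite xE !mem_cat inE orbCA -mem_cat kx orbT.
  by move: kx; rewrite mem_cat => /orP[/h1|/h2].
rewrite aj /=; rewrite eE xE -catA in av; have : M i' j <> 3.
  by apply: (avoids_gap3 _ _ av) => k kx; apply: h; rewrite mem_cat kx ?orbT.
rewrite /= /path_m (negPf ij); move: aj; rewrite /adj.
rewrite [val j == _]eq_sym [val i' == _]eq_sym.
case: (eqVneq i'.+1 (val j)) => [_ _|_ /= ->]; first by case: (lab34 i') => ->.
by case: (lab34 j) => ->.
Qed.

Lemma avoids_gap_double e (j i : 'I_r) : M j i = 4 ->
    (forall k, adj j k -> k = i) ->
  avoids M e -> gap_double j i (map val e).
Proof.
move=> mji endj av.
have ji : j != i by apply: contra_eq_neq mji => ->; rewrite cox_diag.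
have commj (y : seq 'I_r) : val i \notin map val y -> val j \notin map val y ->
    forall k, k \in y -> M j k = 2.
  rewrite !(mem_map val_inj) => iy jy k ky; apply: path_comm.
    by apply: contraNneq jy => ->.
  by apply: contra iy => /endj <-.
have aij : adj i j.
  by have := path_adj ji; rewrite /adj orbC mji => <-.
have splitx (x : seq 'I_r) : val i \notin map val x -> val j \in map val x ->
    nb i (map val x) = 1 -> exists x1 x2,
    [/\ x = x1 ++ j :: x2, forall k, k \in x1 ++ x2 -> M i k = 2
      & forall k, k \in x1 ++ x2 -> M j k = 2].
  move=> ix jx; rewrite /nb count_map => /count1_split[x1 [j' [x2 [xE /= aj' h1 h2]]]].
  have j'E : j' = j.
    move: jx; rewrite (mem_map val_inj) xE mem_cat inE.
    by move=> /or3P[/h1|/eqP->//|/h2]; rewrite /= aij.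
  rewrite j'E in xE; exists x1, x2.
  have nx k : k \in x1 ++ x2 -> i != k.
    move=> kx; apply: contraNneq ix => ->; rewrite (mem_map val_inj).
    by rewrite xE !mem_cat inE orbCA -mem_cat kx orbT.
  have comi k : k \in x1 ++ x2 -> M i k = 2.
    move=> kx; apply: (path_comm (nx k kx)).
    by move: kx; rewrite mem_cat => /orP[/h1|/h2].
  split=> // k kx; apply: path_comm.
    by apply: contra_eq_neq (comi k kx) => <-; rewrite cox_sym mji.
  by apply: contra (nx k kx) => /endj ->.
split.
- move=> u y x v w0.
  have [u' [j1 [v1 [eE _ /val_inj j1E /esym w1]]]] := map_cat_cons_inv w0.
  have [y' [i2 [v2 [v1E -> /val_inj i2E /esym w2]]]] := map_cat_cons_inv w1.
  have [x' [i3 [v3 [v2E -> /val_inj i3E _]]]] := map_cat_cons_inv w2.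
  rewrite v1E v2E -i3E -i2E -j1E in eE.
  move=> iy jy ix jx nx; have [x1 [x2 [xE comi comj]]] := splitx _ ix jx nx.
  rewrite eE xE -catA in av.
  apply: (avoids_gap4 _ _ _ _ av) mji => k kx; first exact: commj kx.
  + by apply: comj; rewrite mem_cat kx.
  + by apply: comi; rewrite mem_cat kx.
  + by apply: comi; rewrite mem_cat kx orbT.
- move=> u x y v w0.
  have [u' [i1 [v1 [eE _ /val_inj i1E /esym w1]]]] := map_cat_cons_inv w0.
  have [x' [i2 [v2 [v1E -> /val_inj i2E /esym w2]]]] := map_cat_cons_inv w1.
  have [y' [j3 [v3 [v2E -> /val_inj j3E _]]]] := map_cat_cons_inv w2.
  rewrite v1E v2E -j3E -i2E -i1E in eE.
  move=> iy jy ix jx nx; have [x1 [x2 [xE comi comj]]] := splitx _ ix jx nx.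
  rewrite eE xE -catA in av; rewrite cox_sym in mji.
  apply: (avoids_gap4' _ _ _ _ av) mji => k kx; first exact: commj kx.
  + by apply: comj; rewrite mem_cat kx orbT.
  + by apply: comi; rewrite mem_cat kx.
  + by apply: comi; rewrite mem_cat kx orbT.
Qed.

End PathWords.

(** * Rotations and the symmetry of the path *)

Section NumberWords.
Implicit Types (E u v w x y : seq nat) (i j k l n p c : nat).

Lemma rot_rot_ex (T : Type) (s : seq T) r1 r2 :
  exists r, rot r1 (rot r2 s) = rot r s.
Proof.
have [h2|/ltnW h2] := leqP r2 (size s); last by exists r1; rewrite (rot_oversize h2).
have [h1|/ltnW h1] := leqP r1 (size s); last first.
  by exists r2; rewrite rot_oversize ?size_rot.
by rewrite rot_add_mod //; eexists.
Qed.

Lemma rot_sym_ex (T : Type) (s t : seq T) r : rot r s = t -> exists r', s = rot r' t.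
Proof.
move=> <-; have [h|/ltnW h] := leqP r (size s); last by exists 0; rewrite rot0 rot_oversize.
by exists (size s - r); rewrite -{1}(rotK r s) /rotr size_rot.
Qed.

Lemma rot_ind (T : Type) (P : seq T -> Prop) s r :
  (forall t, P t -> P (rot 1 t)) -> P s -> P (rot r s).
Proof.
move=> Prot Ps; elim: r => [|r IH]; first by rewrite rot0.
have [h|h] := ltnP r (size s); first by rewrite rotS //; exact: Prot.
by rewrite rot_oversize // (leq_trans h).
Qed.

Lemma filter_rot_ex (T : Type) (a : pred T) (s : seq T) r :
  exists r', filter a (rot r s) = rot r' (filter a s).
Proof.
exists (size (filter a (take r s))).
by rewrite -{3}(cat_take_drop r s) filter_cat rot_size_cat /rot filter_cat.
Qed.

Lemma count_rot (T : Type) (a : pred T) (s : seq T) r : count a (rot r s) = count a s.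
Proof. by rewrite /rot count_cat addnC -count_cat cat_take_drop. Qed.

Lemma count2_split (T : eqType) (a : T) (s : seq T) : 1 < count_mem a s ->
  exists s1 s2 s3, s = s1 ++ a :: s2 ++ a :: s3 /\ a \notin s2.
Proof.
have split1 (t : seq T) : 0 < count_mem a t ->
    exists t1 t2, t = t1 ++ a :: t2 /\ a \notin t1.
  elim: t => //= b t IH; have [-> _|ba] := eqVneq b a; first by exists [::], t.
  rewrite add0n => /IH[t1 [t2 [-> at1]]]; exists (b :: t1), t2; split=> //.
  by rewrite inE negb_or eq_sym ba.
elim: s => //= b s IH; have [->|ba] := eqVneq b a.
  rewrite add1n ltnS => /split1[t1 [t2 [-> at1]]].
  by exists [::], t1, t2.
rewrite add0n => /IH[u [y [v [-> ay]]]].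
by exists (b :: u), y, v.
Qed.

Lemma nbE i x :
  nb i x = count_mem i.+1 x + (if i is i'.+1 then count_mem i' x else 0).
Proof.
rewrite /nb; elim: x => [|k x IH] /=; first by case: i.
rewrite IH /adj; case: i {IH} => [|i]; first by rewrite /= orbF !addn0.
rewrite eqSS [i == k]eq_sym /=.
by have [->|_] := eqVneq k i.+2; [rewrite (_ : i.+2 == i = false)|]; lia.
Qed.

(** Everything that the classification uses about words of type [C~]. *)
Definition Cgap_rules n E :=
  [/\ all (fun k => k <= n) E, gap_nonempty E,
      gap_simple (fun i j => (if i.+1 == j then Ctilde_lab n i
                              else Ctilde_lab n j) == 4) E
    & gap_double 0 1 E /\ gap_double n n.-1 E].

Definition Ccyc n E := forall r, Cgap_rules n (rot r E).

Definition flip n E := map (subn n) E.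

Lemma flipK n E : all (fun k => k <= n) E -> flip n (flip n E) = E.
Proof.
move=> /allP En; rewrite /flip -map_comp -[RHS]map_id; apply/eq_in_map => k /En /=.
by move=> kn; rewrite subKn.
Qed.

Lemma all_flip n E : all (fun k => k <= n) (flip n E).
Proof. by apply/allP => _ /mapP[k _ ->]; exact: leq_subr. Qed.

Lemma count_flip n E i : all (fun k => k <= n) E -> i <= n ->
  count_mem i (flip n E) = count_mem (n - i) E.
Proof.
move=> /allP En i_n; rewrite /flip count_map; apply: eq_in_count => k /En /= kn.
by apply/eqP/eqP; lia.
Qed.

Lemma mem_flip n E i : all (fun k => k <= n) E -> i <= n ->
  (i \in flip n E) = (n - i \in E).
Proof. by move=> En i_n; rewrite -!has_pred1 !has_count count_flip. Qed.

Lemma nb_flip n i x : all (fun k => k <= n) x -> i <= n ->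
  nb i (flip n x) = nb (n - i) x.
Proof.
move=> /allP xn i_n; rewrite /nb /flip count_map; apply: eq_in_count => k /xn /= kn.
by rewrite /adj; lia.
Qed.

Lemma flip_rules n E : 2 <= n -> Cgap_rules n E -> Cgap_rules n (flip n E).
Proof.
move=> n2 [En ne simp [dbl0 dbln]].
have inv u : flip n E = u -> E = flip n u /\ all (fun k => k <= n) u.
  by move=> <-; rewrite flipK // all_flip.
split.
- exact: all_flip.
- move=> u i x v /inv[EE]; rewrite all_cat /= all_cat /= => /and5P[un i_n xn _ vn] ix.
  have := ne (flip n u) (n - i) (flip n x) (flip n v).
  rewrite EE /flip !(map_cat, map_cons) mem_flip ?nb_flip ?leq_subr // subKn //.
  by apply.
- move=> u i x v /inv[EE]; rewrite all_cat /= all_cat /= => /and5P[un i_n xn _ vn] ix nx.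
  have [] := simp (flip n u) (n - i) (flip n x) (flip n v).
  + by rewrite EE /flip !(map_cat, map_cons).
  + by rewrite mem_flip ?leq_subr // subKn.
  + by rewrite nb_flip ?leq_subr // subKn.
  move=> j /mapP[k kx ->] H; exists k => //; move: H; have kn := allP xn k kx.
  rewrite /adj /Ctilde_lab.
  repeat case: ifP; lia.
- have aux j j' i i' : j' = n - j -> i' = n - i -> i <= n -> j <= n ->
     gap_double j i E -> gap_double j' i' (flip n E).
    move=> -> -> i_n j_n [d1 d2]; split.
    + move=> u y x v /inv[EE]; rewrite all_cat /= all_cat /= all_cat /=.
      case/and4P=> un _ yn /and4P[_ xn _ vn] iy jy ix jx nx.
      apply: (d1 (flip n u) (flip n y) (flip n x) (flip n v)).
      * by rewrite EE /flip !(map_cat, map_cons) !subKn.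
      * by rewrite mem_flip.
      * by rewrite mem_flip.
      * by rewrite mem_flip.
      * by rewrite mem_flip.
      * by rewrite nb_flip.
    + move=> u x y v /inv[EE]; rewrite all_cat /= all_cat /= all_cat /=.
      case/and4P=> un _ xn /and4P[_ yn _ vn] iy jy ix jx nx.
      apply: (d2 (flip n u) (flip n x) (flip n y) (flip n v)).
      * by rewrite EE /flip !(map_cat, map_cons) !subKn.
      * by rewrite mem_flip.
      * by rewrite mem_flip.
      * by rewrite mem_flip.
      * by rewrite mem_flip.
      * by rewrite nb_flip.
  split; first by apply: aux dbln; lia.
  by apply: aux dbl0; lia.
Qed.

Lemma flip_cyc n E : 2 <= n -> Ccyc n E -> Ccyc n (flip n E).
Proof. by move=> n2 cE r; rewrite /flip -map_rot; exact: flip_rules. Qed.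

(** * Cyclic sequences of gaps *)

Definition blk i (xs : seq (seq nat)) := flatten [seq i :: x | x <- xs].

Lemma blk_split i E : exists x xs,
  [/\ E = x ++ blk i xs, i \notin x & all (fun y => i \notin y) xs].
Proof.
elim: E => [|k E [x [xs [-> ix ixs]]]]; first by exists [::], [::].
have [->|ki] := eqVneq k i; first by exists [::], (x :: xs); split; rewrite /= ?ix.
by exists (k :: x), xs; split; rewrite // inE negb_or eq_sym ki.
Qed.

Lemma count_blk i xs l : l != i ->
  count_mem l (blk i xs) = \sum_(x <- xs) count_mem l x.
Proof.
move=> li; elim: xs => [|x xs IH]; first by rewrite big_nil.
by rewrite big_cons -IH /= count_cat [i == l]eq_sym (negPf li).
Qed.

Lemma count_blk_sep i xs : all (fun y => i \notin y) xs ->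
  count_mem i (blk i xs) = size xs.
Proof.
elim: xs => //= x xs IH /andP[ix /IH <-].
by rewrite count_cat eqxx (count_memPn ix).
Qed.

(** The cyclic word [E] cut at its occurrences of [i]. The gaps are indexed by
    all natural numbers, with period [c], to spare the case distinction between
    a gap and the one that wraps around. *)
Record gap_seq i E c (X : nat -> seq nat) : Prop := GapSeq {
  gs_period : forall j, X (j + c) = X j;
  gs_free : forall j, i \notin X j;
  gs_whole : forall j, exists r, rot r E = blk i (mkseq (fun k => X (j + k)) c) }.

Lemma gap_seqP i E : i \in E -> exists X, gap_seq i E (count_mem i E) X.
Proof.
move=> iE; have [x [xs [E'E ix ixs]]] := blk_split i (drop (index i E).+1 E ++ take (index i E) E).
have rotE : rot (index i E) E = blk i (x :: xs).
  by rewrite rot_index //= E'E.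
set ys := x :: xs in rotE; pose X j := nth [::] ys (j %% size ys).
have c0 : 0 < size ys by [].
have -> : count_mem i E = size ys.
  by rewrite -(count_rot _ _ (index i E)) rotE count_blk_sep //= ix.
exists X; split=> // [j|j|j].
- by rewrite /X modnDr.
- have iys : all (fun y => i \notin y) ys by rewrite /= ix.
  by rewrite (allP iys) // mem_nth // ltn_mod.
- have -> : mkseq (fun k => X (j + k)) (size ys) = rot (j %% size ys) ys.
    have jc := ltn_pmod j c0; apply: (@eq_from_nth _ [::]); rewrite size_mkseq ?size_rot //.
    move=> k kc; rewrite nth_mkseq // /X /rot nth_cat size_drop nth_drop -modnDml.
    move: jc; generalize (j %% size ys) => q qc.
    case: ltnP => h; first by rewrite modn_small //; lia.
    rewrite nth_take; last by lia.
    by rewrite -[in LHS](@subnK (size ys) (_ + k)) ?modnDr ?modn_small; [congr nth; lia|lia|lia].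
  have -> : blk i (rot (j %% size ys) ys) =
            rot (size (blk i (take (j %% size ys) ys))) (blk i ys).
    rewrite -[X in _ = rot _ (blk i X)](cat_take_drop (j %% size ys) ys) /blk map_cat flatten_cat rot_size_cat.
    by rewrite /rot map_cat flatten_cat.
  rewrite -rotE; set q := size _; have [r rE] := rot_rot_ex E q (index i E).
  by exists r.
Qed.

Section GapSeq.
Variables (i : nat) (E : seq nat) (c : nat) (X : nat -> seq nat).
Hypothesis gX : gap_seq i E c X.

Lemma gs_sum l : l != i -> count_mem l E = \sum_(0 <= k < c) count_mem l (X k).
Proof.
move=> li; have [r rE] := gs_whole gX 0.
by rewrite -(count_rot _ _ r) rE count_blk // /mkseq big_map /index_iota subn0.
Qed.

Lemma gs_two j : 1 < c ->
  exists r v, rot r E = i :: X j ++ i :: X j.+1 ++ v.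
Proof.
move=> c1; have [r rE] := gs_whole gX j; exists r.
move: rE; case: c c1 => [|[|c']] // _; rewrite /mkseq /= addn0 addn1 => ->.
by eexists.
Qed.

(** Same as [gs_two], started just after an occurrence of [i] so as to end with
    one; when [c = 2] the last [i] is the first one of [gs_two]. *)
Lemma gs_two_r j : 1 < c ->
  exists r v, rot r E = X j ++ i :: X j.+1 ++ i :: v.
Proof.
move=> c1; have [r rE] := gs_whole gX j.
have [r' r'E] := rot_rot_ex E 1 r; exists r'; rewrite -r'E rE.
case: c c1 => [|[|c']] // _; rewrite /blk /mkseq /= addn0 addn1 rot1_cons.
set t := flatten _; have [v tv] : exists v, rcons t i = i :: v.
  by rewrite /t; case: (iota 2 c') => [|k l] /=; eexists.
by exists v; rewrite -tv -!cats1 -!catA /= -catA.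
Qed.

End GapSeq.

(** * Averaging over the gaps *)

Lemma sum_shift (a : nat -> nat) c : a c = a 0 ->
  \sum_(0 <= k < c) a k.+1 = \sum_(0 <= k < c) a k.
Proof.
move=> ac; apply: (@addnI (a 0)).
by rewrite -big_nat_recl // big_nat_recr //= ac addnC.
Qed.

Lemma sum_tight (b : nat -> nat) c d : (forall k, k < c -> d <= b k) ->
  \sum_(0 <= k < c) b k <= c * d -> forall k, k < c -> b k = d.
Proof.
elim: c => // c IH bd; rewrite big_nat_recr //= mulSn => le k.
have le' : c * d <= \sum_(0 <= k < c) b k.
  rewrite -[c in c * d]subn0 -sum_nat_const_nat big_nat [X in _ <= X]big_nat.
  by apply: leq_sum => l /andP[_ lc]; apply: bd; exact: ltnW.
have bc := bd c (ltnSn c).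
rewrite ltnS leq_eqVlt => /predU1P[->|]; first by lia.
by apply: IH => [l lc|]; [apply: bd; lia|lia].
Qed.

Lemma last_split (T : eqType) (a : T) (s : seq T) : a \in s ->
  exists s1 s2, s = s1 ++ a :: s2 /\ a \notin s2.
Proof.
elim: s => // b s IH; rewrite inE.
have [/IH[s1 [s2 [-> h]]] _|as_] := boolP (a \in s); first by exists (b :: s1), s2.
by rewrite orbF => /eqP <-; exists [::], s.
Qed.

Lemma first_split (T : eqType) (a : T) (s : seq T) : a \in s ->
  exists s1 s2, s = s1 ++ a :: s2 /\ a \notin s1.
Proof.
rewrite -mem_rev => /last_split[s1 [s2 [/(canRL revK) -> h]]].
exists (rev s2), (rev s1); rewrite mem_rev; split=> //.
by rewrite rev_cat rev_cons cat_rcons.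
Qed.

(** The word [i, i + 1, ..., n, ..., i + 1, i]. *)
Definition updown i n := iota i (n - i) ++ n :: rev (iota i (n - i)).

Lemma updownS i n : i < n -> updown i n = i :: rcons (updown i.+1 n) i.
Proof.
move=> lt_in; rewrite /updown (_ : n - i = (n - i.+1).+1); last by lia.
by rewrite /= rev_cons rcons_cat rcons_cons.
Qed.

Lemma size_updown i n : size (updown i n) = (n - i).*2.+1.
Proof. by rewrite size_cat /= size_rev size_iota; lia. Qed.

Section Classification.
Variable n : nat.
Hypothesis n2 : 2 <= n.

Lemma Cgap_simpleE E u i x v : Cgap_rules n E -> 0 < i < n ->
    E = u ++ i :: x ++ i :: v -> i \notin x -> nb i x = 1 ->
  (i = 1 /\ 0 \in x) \/ (i = n.-1 /\ n \in x).
Proof.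
move=> [_ _ simp _] i_n EE ix nx; have [j jx /andP[aj lj]] := simp _ _ _ _ EE ix nx.
have : (i = 1 /\ j = 0) \/ (i = n.-1 /\ j = n).
  by move: aj lj; rewrite /adj /Ctilde_lab; repeat case: ifP; lia.
by case=> -[iE jE]; [left|right]; split=> //; rewrite -jE.
Qed.

(** Between two occurrences of [i] with no [i - 1] in between, the letters
    [i + 1] occur twice with no [i] in between, and so on up to [n]. *)
Lemma gap_updown E u i x v : Cgap_rules n E -> 0 < i < n ->
    E = u ++ i :: x ++ i :: v -> i \notin x -> i.-1 \notin x ->
  subseq (updown i.+1 n) x.
Proof.
move=> rE; have [d] := ubnP (n - i); elim: d => // d IH in u i x v *.
move=> lt_d i_n EE ix i1x.
have c1 : count_mem i.-1 x = 0 by exact/count_memPn.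
have nbx : nb i x = count_mem i.+1 x.
  by rewrite nbE; case: i i_n c1 {lt_d EE ix i1x} => //= i _ ->; rewrite addn0.
have ne : 0 < nb i x by case: rE => _ ne _ _; exact: ne EE ix.
have [in1|in1] := eqVneq i.+1 n.
  rewrite /updown in1 subnn /= sub1seq -has_pred1 has_count.
  by move: ne; rewrite nbx in1.
have c2 : 1 < count_mem i.+1 x.
  rewrite -nbx ltn_neqAle ne andbT eq_sym; apply/negP => /eqP n1.
  case: (Cgap_simpleE rE i_n EE ix n1) => -[i1 H]; last by lia.
  by move: i1x; rewrite i1 H.
have [s1 [s2 [s3 [xE is2]]]] := count2_split c2.
have is2' : i \notin s2.
  by apply: contra ix; rewrite xE mem_cat inE mem_cat => ->; rewrite !orbT.
have sub : subseq (updown i.+2 n) s2.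
  apply: (IH (u ++ i :: s1) i.+1 s2 (s3 ++ i :: v)) => //; try lia.
  by rewrite EE xE /= -!catA /= -!catA.
rewrite updownS ?xE; last by lia.
apply: subseq_trans (suffix_subseq s1 _).
rewrite -cat1s -(cat1s _ (s2 ++ _)); apply: cat_subseq => //.
by rewrite -cats1; apply: cat_subseq => //; rewrite sub1seq mem_head.
Qed.

Section Gaps.
Variables (E : seq nat) (i c : nat) (X : nat -> seq nat).
Hypotheses (cE : Ccyc n E) (gX : gap_seq i E c X) (c1 : 1 < c).

Lemma gap_letter_le j : all (fun k => k <= n) (X j).
Proof.
have [r [v rE]] := gs_two gX j c1; have [En _ _ _] := cE r.
by move: En; rewrite rE /= all_cat => /and3P[].
Qed.

Lemma gap_nb_gt0 j : 0 < nb i (X j).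
Proof.
have [r [v rE]] := gs_two gX j c1; have [_ ne _ _] := cE r.
by apply: (ne [::] i (X j) (X j.+1 ++ v)) => //; exact: gs_free gX j.
Qed.

Lemma gap_nb1 j : 0 < i < n -> nb i (X j) = 1 ->
  (i = 1 /\ 0 \in X j) \/ (i = n.-1 /\ n \in X j).
Proof.
move=> i_n; have [r [v rE]] := gs_two gX j c1.
exact: (Cgap_simpleE (cE r) (u := [::]) i_n rE (gs_free gX j)).
Qed.

Lemma gs_per k j : X (j + k * c) = X j.
Proof.
by elim: k => [|k IH]; rewrite ?addn0 // mulSn addnCA addnC (gs_period gX).
Qed.

Lemma gs_mod j : X j = X (j %% c).
Proof. by rewrite {1}(divn_eq j c) addnC gs_per. Qed.

Lemma gs_all (P : seq nat -> Prop) :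
  (forall j, j < c -> P (X j)) -> forall j, P (X j).
Proof. by move=> PX j; rewrite gs_mod; apply: PX; rewrite ltn_mod ltnW. Qed.

(** A lower bound valid in each gap bounds the multiplicity from below, and if
    the total is no larger then it is reached in each gap. The variants on pairs
    are for bounds that only hold on two consecutive gaps together. *)
Lemma gs_sum_ge l d : l != i -> (forall j, d <= count_mem l (X j)) ->
  c * d <= count_mem l E.
Proof.
move=> li le; rewrite (gs_sum gX li).
rewrite -[c in c * d]subn0 -sum_nat_const_nat big_nat [X in _ <= X]big_nat.
by apply: leq_sum.
Qed.

Lemma gs_sum_tight l d : l != i -> (forall j, d <= count_mem l (X j)) ->
  count_mem l E <= c * d -> forall j, count_mem l (X j) = d.
Proof.
move=> li le; rewrite (gs_sum gX li) => tight.
apply: (@gs_all (fun x => count_mem l x = d)).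
exact: (sum_tight (fun k _ => le k) tight).
Qed.

Lemma gs_pair_sum l : l != i ->
  \sum_(0 <= k < c) (count_mem l (X k) + count_mem l (X k.+1)) = (count_mem l E).*2.
Proof.
move=> li; rewrite big_split /= (@sum_shift (fun k => count_mem l (X k))).
  by rewrite -(gs_sum gX li) addnn.
by rewrite -(gs_period gX 0).
Qed.

Lemma gs_pair_ge l d : l != i ->
    (forall j, d <= count_mem l (X j) + count_mem l (X j.+1)) ->
  c * d <= (count_mem l E).*2.
Proof.
move=> li le; rewrite -(gs_pair_sum li).
rewrite -[c in c * d]subn0 -sum_nat_const_nat big_nat [X in _ <= X]big_nat.
by apply: leq_sum.
Qed.

Lemma gs_pair_tight l d : l != i ->
    (forall j, d <= count_mem l (X j) + count_mem l (X j.+1)) ->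
    (count_mem l E).*2 <= c * d ->
  forall j, count_mem l (X j) + count_mem l (X j.+1) = d.
Proof.
move=> li le; rewrite -(gs_pair_sum li) => tight j.
have := sum_tight (fun k _ => le k) tight (ltn_pmod j (ltnW c1)).
rewrite -gs_mod; congr (_ + _ = _).
by rewrite gs_mod -[in RHS]addn1 -[in LHS]addn1 modnDml -gs_mod.
Qed.

(** In this section [a] is an end of the path, with [i] as its only neighbour. *)
Section End.
Variable a : nat.
Hypothesis nb_a : forall y, all (fun k => k <= n) y -> nb a y = count_mem i y.
Hypothesis dbl_a : forall r, gap_double a i (rot r E).

Lemma gap_end_le1 j : count_mem a (X j) <= 1.
Proof.
rewrite leqNgt; apply/negP => /count2_split[s1 [s2 [s3 [xE as2]]]].
have Xn := gap_letter_le j; have iX := gs_free gX j.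
have [r [v rE]] := gs_two gX j c1; have [_ ne _ _] := cE r.
have := ne (i :: s1) a s2 (s3 ++ i :: X j.+1 ++ v).
rewrite rE xE /= -!catA /= -!catA => /(_ erefl as2).
move: Xn iX; rewrite xE all_cat /= all_cat mem_cat inE mem_cat.
case/and4P=> _ _ s2n _; rewrite !negb_or => /and4P[_ _ is2 _].
by rewrite nb_a // (count_memPn is2).
Qed.

Lemma gap_end_next j : nb i (X j) = 1 -> a \in X j -> a \notin X j.+1.
Proof.
move=> n1 aX; apply/negP => /first_split[s1 [s2 [xE as1]]].
have [r [v rE]] := gs_two gX j c1; have [_ d2] := dbl_a r.
have := d2 [::] (X j) s1 (s2 ++ v); rewrite rE xE /= -!catA /=; apply=> //.
- by have := gs_free gX j.+1; rewrite xE mem_cat negb_or => /andP[].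
- exact: gs_free gX j.
Qed.

Lemma gap_end_prev j : nb i (X j.+1) = 1 -> a \in X j.+1 -> a \notin X j.
Proof.
move=> n1 aX; apply/negP => /last_split[s1 [s2 [xE as2]]].
have [r [v rE]] := gs_two_r gX j c1; have [d1 _] := dbl_a r.
have := d1 s1 s2 (X j.+1) v; rewrite rE xE /= -!catA /=; apply=> //.
- by have := gs_free gX j; rewrite xE mem_cat inE !negb_or => /and3P[].
- exact: gs_free gX j.+1.
Qed.

End End.
End Gaps.
End Classification.

(** * The pattern of the gaps near an end *)

Section Classification.
Variable n : nat.
Hypothesis n2 : 2 <= n.

Lemma nb_end0 y : all (fun k => k <= n) y -> nb 0 y = count_mem 1 y.
Proof. by move=> _; rewrite nbE addn0. Qed.

Lemma nb_endn y : all (fun k => k <= n) y -> nb n y = count_mem n.-1 y.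
Proof.
move=> /allP yn; rewrite nbE (count_memPn _).
  by case: n n2.
by apply/negP => /yn; rewrite ltnn.
Qed.

Section FirstGap.
Variables (E : seq nat) (c : nat) (X : nat -> seq nat).
Hypotheses (cE : Ccyc n E) (gX : gap_seq 1 E c X) (c1 : 1 < c).

Let z j := count_mem 0 (X j).
Let f j := count_mem 2 (X j).

Let nbX j : nb 1 (X j) = f j + z j.
Proof. exact: nbE. Qed.

Let zf j : 0 < f j + z j.
Proof. by rewrite -nbX; exact: gap_nb_gt0 cE gX c1 j. Qed.

Let dbl0 r : gap_double 0 1 (rot r E).
Proof. by have [_ _ _ []] := cE r. Qed.

(* Consecutive occurrences of 0 are separated by a 1. *)
Let z_le1 j : z j <= 1.
Proof. exact: (gap_end_le1 cE gX c1 nb_end0). Qed.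

(* Otherwise [1010] would be a factor, up to commutations; for [f_prev] it would
   be [0101]. *)
Let f_next j : f j = 0 -> z j.+1 = 0.
Proof.
move=> f0; apply/count_memPn; apply: (gap_end_next gX c1 dbl0).
  by rewrite nbX; move: (z_le1 j) (zf j); rewrite f0; lia.
by rewrite -has_pred1 has_count; move: (zf j); rewrite f0.
Qed.

Let f_prev j : f j.+1 = 0 -> z j = 0.
Proof.
move=> f0; apply/count_memPn; apply: (gap_end_prev gX c1 dbl0).
  by rewrite nbX; move: (z_le1 j.+1) (zf j.+1); rewrite f0; lia.
by rewrite -has_pred1 has_count; move: (zf j.+1); rewrite f0.
Qed.

(* The letter 2 is not an end, so a gap without 0 needs two of them. *)
Let z_f2 j : 2 < n -> z j = 0 -> 2 <= f j.
Proof.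
move=> n3 z0; have := zf j; rewrite z0 addn0 leq_eqVlt => /predU1P[f1|//].
have [||[_]|[]] := gap_nb1 n2 cE gX c1 (j := j); try lia.
  by rewrite nbX z0 addn0 -f1.
by rewrite -has_pred1 has_count -[count _ _]/(z j) z0.
Qed.

Let f_pair j : 2 < n -> 2 <= f j + f j.+1.
Proof.
move=> n3; have := @z_f2 j n3; have := @z_f2 j.+1 n3.
by have := @f_next j; have := @f_prev j; lia.
Qed.

Lemma first_count : 2 < n -> c <= count_mem 2 E.
Proof.
move=> n3; have := gs_pair_ge gX (isT : 2 != 1) (fun j => f_pair j n3); lia.
Qed.

(** As two consecutive gaps contain at least two letters 2, the hypothesis forces
    exactly two. Then a gap that lacks 0 or 2 determines the next one, so that
    one such gap makes the whole cyclic word alternate. For [n = 2] the letter 2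
    is an end too, and the same propagation comes from the symmetry between 0
    and 2. *)
Lemma first_gap_dichotomy : (2 < n -> count_mem 2 E <= c) ->
  (forall j, z j = 1 /\ f j = 1) \/ (forall j, z j + z j.+1 = 1).
Proof.
move=> c2.
have [z_next all_z] :
    (forall j, z j = 0 -> f j.+1 = 0) /\
    ((forall j, z j = 1 /\ 0 < f j) -> forall j, z j = 1 /\ f j = 1).
  have [n3|n_le2] := ltnP 2 n.
    have tight : forall j, f j + f j.+1 = 2.
      by apply: (gs_pair_tight gX c1 _ (fun j => f_pair j n3)) => //; have := c2 n3; lia.
    split=> [j z0|all_z j]; first by have := z_f2 n3 z0; have := tight j; lia.
    by have [zj fj] := all_z j; have [_ fj1] := all_z j.+1; have := tight j; lia.
  have nE : n = 2 by lia.
  have dbl2 r : gap_double 2 1 (rot r E).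
    by have [_ _ _ [_]] := cE r; rewrite nE.
  have nb2 y : all (fun k => k <= n) y -> nb 2 y = count_mem 1 y.
    by move/nb_endn; rewrite nE.
  have f_le1 j : f j <= 1 by exact: (gap_end_le1 cE gX c1 nb2).
  split=> [j z0|all_z j]; last by have [zj fj] := all_z j; have := f_le1 j; lia.
  apply/count_memPn; apply: (gap_end_next gX c1 dbl2).
    by rewrite nbX; move: (f_le1 j) (zf j); rewrite z0; lia.
  by rewrite -has_pred1 has_count; move: (zf j); rewrite z0 addn0.
have step j : z j = 0 \/ f j = 0 -> z j.+1 = 0 \/ f j.+1 = 0.
  by case=> [/z_next|/f_next]; [right|left].
have [/existsP[[j0 jc]] /= j0P|none] :=
    boolP [exists j : 'I_c, (z j == 0) || (f j == 0)].
  right=> j.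
  have : z j = 0 \/ f j = 0.
    have zf_per k : z (j + k * c) = z j /\ f (j + k * c) = f j.
      by rewrite /z /f (gs_per gX).
    have [<- <-] := zf_per j0.
    have : j0 <= j + j0 * c.
      by apply: leq_trans (leq_addl _ _); rewrite leq_pmulr // ltnW.
    elim: (j + j0 * c) => [|k IH].
      rewrite leqn0 => /eqP j00; move: j0P; rewrite j00.
      by case/orP=> /eqP; [left|right].
    rewrite leq_eqVlt => /predU1P[<-|]; last by rewrite ltnS => /IH/step.
    by case/orP: j0P => /eqP; [left|right].
  have := z_le1 j; have := z_le1 j.+1; have := zf j; have := zf j.+1.
  by have := @f_next j; have := @z_next j; lia.
left; apply: all_z => j.
have per : z j = z (j %% c) /\ f j = f (j %% c).
  by rewrite /z /f -(gs_mod gX j).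
case: per => -> ->; have jc : j %% c < c by rewrite ltn_mod ltnW.
move: none; rewrite negb_exists => /forallP/(_ (Ordinal jc)) /=.
by rewrite negb_or -!lt0n; have := z_le1 (j %% c); lia.
Qed.

End FirstGap.

(** Being stated up to rotation, this does not say which letter comes first. *)
Definition alternates i E p :=
  exists r, filter (pred2 i i.+1) (rot r E) = alt i i.+1 p.*2.

Lemma alternates_count i E p : alternates i E p ->
  count_mem i E = p /\ count_mem i.+1 E = p.
Proof.
have ci l F : (l == i) || (l == i.+1) ->
    count_mem l (filter (pred2 i i.+1) F) = count_mem l F.
  by move=> li; rewrite count_filter; apply: eq_count => k /=; case: eqP => // ->.
case=> r rE; have ii : (i.+1 == i) = false by apply/negbTE; rewrite neq_ltn ltnSn orbT.
have := count_rot (pred1 i) E r; have := count_rot (pred1 i.+1) E r.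
rewrite -(ci i) ?eqxx // -(ci i.+1) ?eqxx ?orbT // rE => <- <-.
by elim: p {rE} => //= p [e1 e2]; rewrite !eqxx [i == _]eq_sym ii e1 e2.
Qed.

Lemma rot1_alt (T : Type) (a b : T) p : rot 1 (alt a b p.*2) = alt b a p.*2.
Proof.
case: p => // p; rewrite doubleS /= rot1_cons.
have -> : a :: alt b a p.*2 = alt a b p.*2.+1 by [].
elim: p a b => //= p IH a b; congr [:: _, _ & _].
by have [] := IH a b.
Qed.

Lemma alternates_linear i E p : alternates i E p ->
  filter (pred2 i i.+1) E = alt i i.+1 p.*2 \/
  filter (pred2 i i.+1) E = alt i.+1 i p.*2.
Proof.
case=> r rE; have [r' r'E] := rot_sym_ex (erefl (rot r E)).
have [r'' ->] : exists r'', filter (pred2 i i.+1) E = rot r'' (alt i i.+1 p.*2).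
  by rewrite {1}r'E -rE; exact: filter_rot_ex.
apply: (rot_ind (P := fun s => s = alt i i.+1 p.*2 \/ s = alt i.+1 i p.*2)).
  by move=> _ [->|->]; rewrite rot1_alt; [right|left].
by left.
Qed.

End Classification.

(** * Classification of the cyclic words *)

Lemma filter_gap i l x : i \notin x ->
  filter (pred2 i l) x = nseq (count_mem l x) l.
Proof.
elim: x => //= k x IH; rewrite inE negb_or eq_sym => /andP[/negPf -> /IH ->].
by case: eqP => // ->.
Qed.

Lemma filter_blk i l xs : i != l -> (forall x, x \in xs -> i \notin x /\ count_mem l x = 1) ->
  filter (pred2 i l) (blk i xs) = alt i l (size xs).*2.
Proof.
move=> il; elim: xs => //= x xs IH h.
have [ix lx] := h x (mem_head _ _).
rewrite eqxx /= filter_cat filter_gap // lx /= IH // => y yxs.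
by apply: h; rewrite inE yxs orbT.
Qed.

Lemma size_counts n E : all (fun k => k <= n) E ->
  size E = \sum_(0 <= l < n.+1) count_mem l E.
Proof.
elim: E => [_|k E IH /= /andP[kn /IH ->]]; first by rewrite big1.
rewrite big_split /= -addn1 addnC; congr (_ + _).
rewrite big_mkord (bigD1 (Ordinal (kn : k < n.+1))) //= eqxx big1 // => i.
by rewrite -val_eqE /= eq_sym => /negPf ->.
Qed.

Lemma mkseqSl (T : Type) (f : nat -> T) k :
  mkseq f k.+1 = f 0 :: mkseq (fun j => f j.+1) k.
Proof. by rewrite /mkseq /= -[1]/(1 + 0) iotaDl -map_comp. Qed.

Lemma size_flatten_mkseq (T : Type) (B : nat -> seq T) p :
  size (flatten (mkseq B p)) = \sum_(0 <= k < p) size (B k).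
Proof.
by rewrite size_flatten /shape sumnE big_map /mkseq big_map /index_iota subn0.
Qed.

Lemma sum_gap_nb i E c X : gap_seq i E c X -> \sum_(0 <= k < c) nb i (X k) =
  count_mem i.+1 E + (if i is i'.+1 then count_mem i' E else 0).
Proof.
move=> gX; rewrite (eq_bigr _ (fun k _ => nbE i (X k))) big_split /=.
rewrite -(gs_sum gX); last by rewrite neq_ltn ltnSn orbT.
case: i gX => [|i] gX; first by rewrite big1.
by rewrite -(gs_sum gX) // neq_ltn ltnSn.
Qed.

Lemma gap_nb_mul i E c X d : gap_seq i E c X -> (forall j, d <= nb i (X j)) ->
  c * d <= count_mem i.+1 E + (if i is i'.+1 then count_mem i' E else 0).
Proof.
move=> gX le; rewrite -(sum_gap_nb gX) -[c in c * d]subn0 -sum_nat_const_nat.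
exact: leq_sum.
Qed.

Lemma count_gt0_mem (T : eqType) (a : T) s : 0 < count_mem a s -> a \in s.
Proof. by rewrite -has_count has_pred1. Qed.

Lemma leq_count_uniq (T : eqType) (s : seq T) :
  (forall a, count_mem a s <= 1) -> uniq s.
Proof.
move=> le; apply: count_mem_uniq => a; rewrite -has_pred1 has_count.
by case: (count_mem a s) (le a) => [|[|]].
Qed.

Lemma ex_max n E : all (fun k => k <= n) E ->
  exists i, forall l, count_mem l E <= count_mem i E.
Proof.
move=> /allP En; have cn : 0 < #|'I_n.+1| by rewrite card_ord.
have [i iM] := eq_bigmax (fun k : 'I_n.+1 => count_mem (k : nat) E) cn.
exists i => l; rewrite -iM; have [ln|nl] := leqP l n.
  exact: (leq_bigmax (Ordinal (ln : l < n.+1))).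
by rewrite (count_memPn _) //; apply/negP => /En; rewrite leqNgt nl.
Qed.

Lemma max_count n E M : 1 < M -> all (fun k => k <= n) E ->
    (forall l, count_mem l E <= M) -> forall i, count_mem i E = M ->
  exists i, [/\ i <= n, count_mem i E = M &
                forall l, l < i -> count_mem l E < M].
Proof.
move=> M1 /allP En le i0 i0M.
have ex : exists i, count_mem i E == M by exists i0; rewrite i0M.
case: (ex_minnP ex) => i /eqP iM min_i; exists i; split=> //.
  by apply: En; apply: count_gt0_mem; rewrite iM ltnW.
move=> l li; rewrite ltn_neqAle le andbT; apply/negP => /min_i.
by rewrite leqNgt li.
Qed.

(** One period of the path that bounces between the ends 0 and [n], started at
    the letter 1 because the proof cuts words at the letter 1. *)
Definition zigzag n := [:: 1, 0, 1 & updown 2 n].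

Section Classification.
Variable n : nat.
Hypothesis n2 : 2 <= n.

Lemma alternates_rot i E p r : alternates i E p -> alternates i (rot r E) p.
Proof.
case=> r1 r1E; have [r2 r2E] := rot_sym_ex (erefl (rot r E)).
by have [r3 r3E] := rot_rot_ex (rot r E) r1 r2; exists r3; rewrite -r3E -r2E.
Qed.

(** By hypothesis each gap of [i + 1] contains exactly one [i], hence another
    neighbour, [i + 2]; and there are not enough of these for a second one. *)
Lemma alternates_step i E p : Ccyc n E -> 0 < i -> i.+1 < n -> 1 < p ->
  count_mem i.+2 E <= p -> alternates i E p -> alternates i.+1 E p.
Proof.
move=> cE i0 i_n p1 le alt_i; have [ci ci1] := alternates_count alt_i.
have /gap_seqP[X] : i.+1 \in E by apply: count_gt0_mem; rewrite ci1 ltnW.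
rewrite ci1 => gX.
have i_pos j : 0 < count_mem i (X j).
  rewrite -has_count has_pred1; apply/negPn/negP => iX.
  have [r [v rE]] := gs_two gX j p1.
  have := alternates_linear (alternates_rot r alt_i).
  rewrite rE /= eqxx orbT filter_cat (eq_filter (_ : _ =1 pred2 i.+1 i)); last first.
    by move=> k /=; rewrite orbC.
  have -> : [seq k <- X j | pred2 i.+1 i k] = [::].
    by rewrite filter_gap ?(gs_free gX) // (count_memPn iX).
  rewrite /= eqxx orbT; case: p p1 {ci ci1 alt_i gX le} => // p _.
  by rewrite doubleS /= => -[] []; lia.
have i_one := gs_sum_tight gX p1 (l := i) (d := 1).
have {}i_one : forall j, count_mem i (X j) = 1.
  by apply: i_one => //; [rewrite neq_ltn ltnSn | rewrite muln1 ci].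
have i2_pos j : 0 < count_mem i.+2 (X j).
  rewrite lt0n; apply/negP => /eqP i2.
  have n1 : nb i.+1 (X j) = 1 by rewrite nbE i2 i_one.
  have [|[]|[i1n nX]] := gap_nb1 n2 cE gX p1 _ n1; try lia.
  by move: nX; rewrite -has_pred1 has_count (_ : n = i.+2) ?i2 //; lia.
have i2_one : forall j, count_mem i.+2 (X j) = 1.
  by apply: (gs_sum_tight gX p1) => //; [rewrite neq_ltn ltnSn orbT | rewrite muln1].
have [r rE] := gs_whole gX 0; exists r; rewrite rE filter_blk ?size_mkseq //.
  by rewrite neq_ltn ltnSn.
by move=> _ /mapP[k _ ->]; rewrite i2_one (gs_free gX).
Qed.

Lemma alternates_all E c X : Ccyc n E -> gap_seq 1 E c X -> 1 < c ->
    (forall l, count_mem l E <= c) ->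
    (forall j, count_mem 0 (X j) = 1 /\ count_mem 2 (X j) = 1) ->
  forall i, i < n -> alternates i E c.
Proof.
move=> cE gX c1 le one.
have [r rE] := gs_whole gX 0.
elim=> [_|[_ _|i IH i_n]].
- have [r' r'E] := rot_rot_ex E 1 r; exists r'; rewrite -r'E.
  have : filter (pred2 1 0) (rot r E) = alt 1 0 c.*2.
    rewrite rE filter_blk ?size_mkseq // => _ /mapP[k _ ->].
    by rewrite (gs_free gX) (one _).1.
  case: c c1 gX {le r'E} rE => // c _ gX rE.
  rewrite (eq_filter (_ : _ =1 pred2 0 1)); last by move=> k; rewrite /= orbC.
  rewrite -[alt 0 1 _]rot1_alt => <-; rewrite rE mkseqSl /= !rot1_cons.
  by rewrite filter_rcons.
- exists r; rewrite rE filter_blk ?size_mkseq // => _ /mapP[k _ ->].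
  by rewrite (gs_free gX) (one _).2.
- by apply: alternates_step => //; apply: IH; exact: ltnW.
Qed.

Lemma all_le E : Ccyc n E -> all (fun k => k <= n) E.
Proof. by move=> cE; have [En _ _ _] := cE 0; rewrite rot0 in En. Qed.

Lemma end_count E a b : Ccyc n E ->
    (forall y, all (fun k => k <= n) y -> nb a y = count_mem b y) -> b != a ->
  1 < count_mem a E -> count_mem a E <= count_mem b E.
Proof.
move=> cE nba ba a1; have /gap_seqP[X gX] : a \in E by exact/count_gt0_mem/ltnW.
rewrite -[count_mem a E]muln1; apply: (gs_sum_ge gX ba) => j.
by rewrite -nba ?(gap_nb_gt0 cE gX) // (gap_letter_le cE gX).
Qed.

(** The multiplicity of a repeated letter is at most the average of those of its
    neighbours or, near an end, at most that of the next inner letter. So the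
    least letter where the maximum is attained cannot exceed 1. *)
Lemma max_at_1 E M i : Ccyc n E -> 1 < M -> (forall l, count_mem l E <= M) ->
  count_mem i E = M -> count_mem 1 E = M.
Proof.
move=> cE M1 le iM.
have {i iM} [i [i_n iM min_i]] := max_count M1 (all_le cE) le iM.
have [i0|i0] := posnP i.
  apply/eqP; rewrite eqn_leq le /= -{1}iM i0.
  by apply: (end_count cE (@nb_end0 n)) => //; move: iM; rewrite i0 => ->.
have [<-//|i1] := eqVneq i 1.
have [i_eq|i_ne] := eqVneq i n.
  have := end_count cE (nb_endn n2); rewrite -i_eq iM => /(_ _ M1).
  by rewrite leqNgt min_i ?prednK // neq_ltn prednK // leqnn => /(_ isT).
have [i_eq|i_ne1] := eqVneq i n.-1.
  have iF : count_mem 1 (flip n E) = M.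
    by rewrite count_flip ?(all_le cE) ?(ltnW n2) // subn1 -i_eq.
  have /gap_seqP[X] : 1 \in flip n E by apply: count_gt0_mem; rewrite iF ltnW.
  have n3 : 2 < n by move: n2 i1; rewrite i_eq; clear; case: n => [|[|[|]]].
  rewrite iF => gX; have := first_count n2 (flip_cyc n2 cE) gX M1 n3.
  rewrite count_flip ?(all_le cE) ?(ltnW n3) // leqNgt => /negP[].
  by apply: min_i; rewrite i_eq; clear -n3; lia.
have /gap_seqP[X] : i \in E by apply: count_gt0_mem; rewrite iM ltnW.
rewrite iM => gX.
(* [i] is now an inner letter whose edges are both labelled 3 *)
have nb2 j : 2 <= nb i (X j).
  rewrite ltn_neqAle (gap_nb_gt0 cE gX) // andbT eq_sym; apply/negP => /eqP n1.
  have [|[]|[]] := gap_nb1 n2 cE gX M1 _ n1; try lia.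
have := gap_nb_mul gX nb2.
by case: i i0 min_i {i1 i_n iM i_ne i_ne1 gX nb2} => // i _ /(_ i (ltnSn _)); have := le i.+2; lia.
Qed.

(** When the gaps between the [1]'s alternate, half of them contain a [0] and
    the others at least an ascent to [n] and the return; the bound on the total
    length leaves no room for anything else. *)
Lemma zigzag_of_pattern E p X : Ccyc n E -> gap_seq 1 E p.*2 X -> 0 < p ->
    (forall j, count_mem 0 (X j) + count_mem 0 (X j.+1) = 1) ->
    size E <= p * n.*2 ->
  exists r, E = rot r (flatten (nseq p (zigzag n))).
Proof.
move=> cE gX p0 pat szE.
have c1 : 1 < p.*2 by lia.
have [j0 j0P] : exists j, count_mem 0 (X j) = 1.
  have := pat 0; case e: (count_mem 0 (X 0)) => [|[|]] //; last by exists 0.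
  by exists 1.
pose Y k := X (j0 + k).
have Yev k : count_mem 0 (Y k.*2) = 1 /\ count_mem 0 (Y k.*2.+1) = 0.
  elim: k => [|k [IH0 IH1]]; first by rewrite /Y addn0 addn1; have := pat j0; lia.
  have := pat (j0 + k.*2.+1); have := pat (j0 + k.*2.+2).
  by rewrite doubleS /Y !addnS in IH0 IH1 *; lia.
pose B k := 1 :: Y k.*2 ++ 1 :: Y k.*2.+1.
have up k : subseq (updown 2 n) (Y k.*2.+1).
  have [r [v rE]] := gs_two gX (j0 + k.*2.+1) c1.
  apply: (gap_updown n2 (cE r) (u := [::]) _ rE) => //; first exact: gs_free gX _.
  by apply/count_memPn; exact: (Yev k).2.
have sY k : 0 < size (Y k.*2).
  by rewrite -(count_predT (Y _)) (leq_trans _ (sub_count (a1 := pred1 0) _ _)) ?(Yev k).1.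
have szB k : n.*2 <= size (B k).
  rewrite /B /= size_cat /=; have := size_subseq (up k); rewrite size_updown => h.
  rewrite (_ : n.*2 = (1 + (n - 2).*2.+2).+1); last by lia.
  by rewrite ltnS leq_add.
have [r rE] := gs_whole gX j0.
have BE : rot r E = flatten (mkseq B p).
  rewrite rE; have pairs q Z : blk 1 (mkseq Z q.*2) =
      flatten (mkseq (fun k => 1 :: Z k.*2 ++ 1 :: Z k.*2.+1) q).
    elim: q Z => // q IH Z; rewrite doubleS !mkseqSl.
    by have := IH (fun k => Z k.+2); rewrite /blk /= -catA /= => ->.
  exact: pairs.
have szr : \sum_(0 <= k < p) size (B k) <= p * n.*2.
  by rewrite -size_flatten_mkseq -BE size_rot.
have tight := sum_tight (fun k _ => szB k) szr.
suff Bz k : k < p -> B k = zigzag n.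
  have {}BE : rot r E = flatten (nseq p (zigzag n)).
    rewrite BE; congr flatten; apply: (@eq_from_nth _ [::]).
      by rewrite size_mkseq size_nseq.
    by rewrite size_mkseq => k kp; rewrite nth_mkseq // nth_nseq kp Bz.
  by have [r' ->] := rot_sym_ex BE; exists r'.
move=> kp; have := tight k kp; rewrite /B /= size_cat /= => sz.
have /leqifP := size_subseq_leqif (up k); have := sY k; rewrite size_updown.
case: (eqVneq (updown 2 n) (Y k.*2.+1)) => [e _ _|_]; last first.
  move=> s0 s1; have {}s1 : (n - 2).*2.+1 < size (Y k.*2.+1) := s1.
  by exfalso; clear -n2 sz s0 s1; lia.
rewrite -e; have sYk : size (Y k.*2) = 1.
  by move: sz; rewrite -e size_updown; clear -n2; lia.
case: (Y k.*2) sYk (Yev k).1 => [|a []] //= _.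
by case: eqP => // ->.
Qed.

(** If some letter is repeated then the dichotomy holds at both ends of the path.
    When either end alternates regularly, so does the whole word. Otherwise the
    two ends have half the maximal multiplicity, which bounds the length of the
    word as required by [zigzag_of_pattern]. *)
Theorem Ccyc_classification E : Ccyc n E ->
  [\/ uniq E,
      exists2 p, 1 < p & forall i, i < n -> alternates i E p
    | exists p r, 0 < p /\ E = rot r (flatten (nseq p (zigzag n)))].
Proof.
move=> cE; have [i le] := ex_max (all_le cE); set M := count_mem i E in le.
have [M1|M1] := leqP M 1.
  by apply: Or31; apply: leq_count_uniq => a; exact: leq_trans (le a) M1.
have c1 := max_at_1 cE M1 le (erefl M).
have dichotomy F : Ccyc n F -> (forall l, count_mem l F <= M) -> count_mem 1 F = M ->
    (forall i, i < n -> alternates i F M) \/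
    (exists2 X, gap_seq 1 F M X &
      forall j, count_mem 0 (X j) + count_mem 0 (X j.+1) = 1).
  move=> cF leF F1; have /gap_seqP[X] : 1 \in F by apply: count_gt0_mem; rewrite F1 ltnW.
  rewrite F1 => gX.
  have [one|pat] := first_gap_dichotomy n2 cF gX M1 (fun _ => leF 2); last by right; exists X.
  by left; exact: alternates_all cF gX M1 leF one.
have [alt|[X gX pat]] := dichotomy E cE le c1; first by apply: Or32; exists M.
have half F Y : gap_seq 1 F M Y ->
    (forall j, count_mem 0 (Y j) + count_mem 0 (Y j.+1) = 1) ->
    (count_mem 0 F).*2 = M.
  move=> gY patY; rewrite -(gs_pair_sum gY) //.
  by rewrite (eq_bigr _ (fun k _ => patY k)) sum_nat_const_nat subn0 muln1.
have c0 := half _ _ gX pat.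
have En := all_le cE.
have leF l : count_mem l (flip n E) <= M.
  have [ln|nl] := leqP l n; first by rewrite count_flip.
  by rewrite (count_memPn _) //; apply/negP => /(allP (all_flip n E)); rewrite leqNgt nl.
have iF : count_mem 1 (flip n E) = M.
  apply: (max_at_1 (i := n.-1) (flip_cyc n2 cE) M1 leF).
  rewrite count_flip ?leq_pred // (_ : n - n.-1 = 1) //.
  by clear -n2; lia.
have [alt|[Y gY patY]] := dichotomy _ (flip_cyc n2 cE) leF iF.
  have n1 : n.-1 < n by rewrite prednK // ltnW.
  have [_] := alternates_count (alt n.-1 n1).
  rewrite prednK ?(ltnW n2) // count_flip // subnn => e0.
  by move: c0; rewrite e0; clear -M1; lia.
have cn := half _ _ gY patY; rewrite count_flip // subn0 in cn.
apply: Or33; exists (count_mem 0 E).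
have p0 : 0 < count_mem 0 E by clear -c0 M1; lia.
rewrite -c0 in gX; have [|r rE] := zigzag_of_pattern cE gX p0 pat; last by exists r.
rewrite (size_counts En) big_nat_recr //= big_ltn; last exact: ltnW.
have : \sum_(1 <= l < n) count_mem l E <= (n - 1) * M.
  by rewrite -sum_nat_const_nat; apply: leq_sum.
have arith m p q s : 0 < m -> p.*2 = M -> q.*2 = M -> s <= (m - 1) * M ->
    p + s + q <= p * m.*2.
  clear; case: m => // m _ pM qM; rewrite subn1 /= -pM => sM.
  have -> : q = p by lia.
  by move: sM; rewrite doubleS -!muln2; nia.
by move=> sM; exact: arith (ltnW n2) c0 cn sM.
Qed.

End Classification.

(** In type [A] every gap contains at least two neighbours, which is impossible
    at the leftmost letter of maximal multiplicity. *)
Theorem Acyc_uniq n E :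
    (forall r, [/\ all (fun k => k <= n) (rot r E), gap_nonempty (rot r E) &
                   gap_simple (fun _ _ => false) (rot r E)]) -> uniq E.
Proof.
move=> cE; have [En _ _] := cE 0; rewrite rot0 in En.
have [i0 le] := ex_max En; set M := count_mem i0 E in le.
have [M1|M1] := leqP M 1.
  by apply: leq_count_uniq => a; exact: leq_trans (le a) M1.
have [i [i_n iM min_i]] := max_count M1 En le (erefl M).
have /gap_seqP[X] : i \in E by apply: count_gt0_mem; rewrite iM ltnW.
rewrite iM => gX.
have nb2 j : 2 <= nb i (X j).
  have [r [v rE]] := gs_two gX j M1; have [_ ne simp] := cE r.
  have iX := gs_free gX j.
  rewrite ltn_neqAle (ne [::] i (X j) (X j.+1 ++ v)) // andbT eq_sym.
  apply/negP => /eqP /(simp [::] _ _ _ rE iX)[k _].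
  by rewrite andbF.
have := gap_nb_mul gX nb2; have := le i.+1.
by case: i min_i {i_n iM gX nb2} => [|i] min_i; [|have := min_i i (ltnSn _)]; lia.
Qed.

End NumberWords.

(** * Commutation classes and their projections *)

(** A complete invariant [cls] of commutation classes spares the choice of
    representatives: its values are counted. *)
Lemma card_CFC (S : finType) (m : coxMatrix S) (T : choiceType)
    (cls : seq S -> T) (k : nat) (V : seq T) :
    uniq V ->
    (forall e f, commutation_equiv m e f <-> cls e = cls f) ->
    (forall w e, is_CFC w -> reduced_expr (m := m) w e -> size e = k -> cls e \in V) ->
    (forall v, v \in V -> exists e,
      [/\ cls e = v, size e = k, reduced_expr (cox_word m e) e
        & is_CFC (cox_word m e)]) ->
  #|` fset_set (CFC_of_length m k)| = size V.
Proof.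
move=> uV clsP CFC_V V_CFC.
have [g gP] : exists g : T -> seq S, forall v, v \in V ->
    [/\ cls (g v) = v, size (g v) = k, reduced_expr (cox_word m (g v)) (g v)
      & is_CFC (cox_word m (g v))].
  suff /choice[g gP] : forall v, exists e, v \in V ->
    [/\ cls e = v, size e = k, reduced_expr (cox_word m e) e
      & is_CFC (cox_word m e)] by exists g.
  move=> v; have [vV|vV] := boolP (v \in V); last by exists [::].
  by have [e eP] := V_CFC v vV; exists e.
have CFC_FC w : is_CFC w -> is_FC w.
  move=> cfc; have [e [we re]] := reduced_ex w.
  have ew : reduced_expr w e by apply/reduced_exprP.
  by have [w' [FCw' []]] := cfc e ew 0; rewrite rot0 -we => ->.
pose W := [seq cox_word m (g v) | v <- V].
have uW : uniq W.
  rewrite map_inj_in_uniq // => v1 v2 /gP[e1 _ r1 c1] /gP[e2 _ r2 _] g12.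
  suff /clsP :  commutation_equiv m (g v1) (g v2) by rewrite e1 e2.
  by rewrite -g12 in r2; exact: CFC_FC c1 _ _ r1 r2.
have -> : CFC_of_length m k = [set` [fset w in W]%fset]%classic.
  apply/seteqP; split=> w /=; rewrite inE /=.
    case=> cfc wk; have [e [we re]] := reduced_ex w.
    have ew : reduced_expr w e by apply/reduced_exprP.
    have ek : size e = k by case: ew => _ ->.
    have vV := CFC_V w e cfc ew ek; have [gv _ rg _] := gP _ vV.
    apply/mapP; exists (cls e) => //; rewrite -we; apply: (@ceq_word _ m).
    by apply: ceq_sym; apply/clsP.
  case/mapP=> v /gP[_ sg rg cg ->]; split=> //.
  by case: rg => _ <-.
by rewrite set_fsetK card_fseq undup_id // size_map.
Qed.

Section PathClasses.
Variables (n : nat) (lab : nat -> nat) (lab_neq1 : forall i, lab i != 1).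
Hypothesis lab34 : forall i, lab i = 3 \/ lab i = 4.
Hypothesis n_gt0 : 0 < n.
Local Notation M := (@path_coxMatrix n.+1 lab lab_neq1).
Implicit Types (e f : seq 'I_n.+1).

(** The complete invariant of commutation classes, by [projectionsP]. *)
Definition projections (e : seq 'I_n.+1) : seq (seq nat) :=
  [seq filter (pred2 i i.+1) (map val e) | i <- iota 0 n].

Lemma projections_eq e f : projections e = projections f <->
  forall i, i < n -> filter (pred2 i i.+1) (map val e) =
                     filter (pred2 i i.+1) (map val f).
Proof.
rewrite /projections; split=> [/eq_in_map H i i_n|H].
  by apply: H; rewrite mem_iota.
by apply/eq_in_map => i; rewrite mem_iota => /andP[_]; exact: H.
Qed.

Lemma ceq_projections e f : commutation_equiv M e f -> projections e = projections f.
Proof.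
move=> ef; apply/projections_eq => i i_n; rewrite !filter_map; congr map.
apply: ceq_filter ef => s t /= si ti st.
by rewrite (path_adj lab_neq1 lab34 st) /adj; move: st si ti; rewrite -val_eqE /=; lia.
Qed.

Lemma mem_projections e f s : projections e = projections f -> s \in e -> s \in f.
Proof.
move/projections_eq => ef se.
pose i := if s < n then val s else n.-1.
have i_n : i < n by rewrite /i; case: ifP => // _; lia.
have : val s \in filter (pred2 i i.+1) (map val e).
  rewrite mem_filter map_f // andbT /i /=; case: ifP => [_|]; first by rewrite eqxx.
  by have := ltn_ord s; lia.
by rewrite (ef _ i_n) mem_filter => /andP[_]; rewrite mem_map //; exact: val_inj.
Qed.

(** The first letter [s] of [e] comes in [f] before all its neighbours, hence
    can be moved to the front. *)
Lemma projections_ceq e f : projections e = projections f -> commutation_equiv M e f.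
Proof.
elim: e f => [|s e IH] f ef.
  case: f ef => [_|t f ef]; first exact: comm_refl.
  by have := mem_projections (esym ef) (mem_head t f).
have /first_split[u [v [fE su]]] := mem_projections ef (mem_head s e).
have comm_u t : t \in u -> M s t = 2.
  move=> tu; have st : s != t by apply: contraNneq su => ->.
  apply: (path_comm lab_neq1 lab34 st); apply/negP => a_st.
  have [i [i_n ais ait]] : exists i, [/\ i < n,
      (val s == i) || (val s == i.+1) & (val t == i) || (val t == i.+1)].
    have edge a b : a < n.+1 -> b < n.+1 -> adj a b -> exists i,
        [/\ i < n, (a == i) || (a == i.+1) & (b == i) || (b == i.+1)].
      clear; rewrite /adj !ltnS => an bn /orP[] /eqP e; [exists a|exists b];
        by rewrite e !eqxx !orbT -e.
    exact: edge a_st.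
  have /projections_eq/(_ i i_n) := ef.
  rewrite fE /= ais map_cat filter_cat.
  case filt: (filter (pred2 i i.+1) (map val u)) => [|a w] /=.
    move=> _; have : val t \in filter (pred2 i i.+1) (map val u).
      by rewrite mem_filter /= ait map_f.
    by rewrite filt.
  case=> sa _; have : val s \in filter (pred2 i i.+1) (map val u).
    by rewrite filt -sa; exact: mem_head.
  by rewrite mem_filter => /andP[_]; rewrite mem_map ?(negPf su) //; exact: val_inj.
have fu : commutation_equiv M f (s :: u ++ v).
  by rewrite fE; apply: ceq_moveL.
apply: ceq_trans (ceq_sym fu); apply: ceq_cons; apply: IH.
have /projections_eq H : projections (s :: e) = projections (s :: u ++ v).
  by rewrite ef; exact: ceq_projections.
by apply/projections_eq => i /H /=; case: ifP => // _ [].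
Qed.

Lemma projectionsP e f : commutation_equiv M e f <-> projections e = projections f.
Proof. by split; [exact: ceq_projections|exact: projections_ceq]. Qed.

(** This list does not mention the Coxeter matrix: it is common to types [A] and
    [C~]. *)
Definition uniq_classes k : seq (seq (seq nat)) :=
  undup [seq projections (tval t) | t <- enum [pred t : k.-tuple 'I_n.+1 | uniq t]].

Lemma uniq_classesP k v : reflect (exists e, [/\ projections e = v, size e = k & uniq e])
  (v \in uniq_classes k).
Proof.
rewrite mem_undup; apply: (iffP mapP) => [[e]|[e [<- ek ue]]].
  by rewrite mem_enum inE => ue ->; exists e; rewrite size_tuple.
exists (tcast ek (in_tuple e)); last by rewrite val_tcast.
by rewrite mem_enum inE val_tcast.
Qed.

Lemma uniq_CFC e : uniq e ->
  reduced_expr (cox_word M e) e /\ is_CFC (cox_word M e).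
Proof.
move=> ue; have exM : cox_exact M := @path_exact n.+1 lab lab_neq1 lab34.
suff [] : [/\ avoids M e, reduced_expr (cox_word M e) e & is_CFC (cox_word M e)] by [].
apply: (CFC_of_stable (K := fun e => uniq e) exM) ue.
- by move=> e1 e2 /ceq_perm/perm_uniq ->.
- by move=> r e1; rewrite rot_uniq.
- by move=> u s v; rewrite !cat_uniq /= mem_head !andbF.
- move=> u s t v; case: (M s t) => [|[|[|k]]] // _.
  by rewrite !cat_uniq /= !inE eqxx !orbT /= !andbF.
Qed.

End PathClasses.

(** * Alternating words *)

Lemma C_lab34 n i : Ctilde_lab n i = 3 \/ Ctilde_lab n i = 4.
Proof. by rewrite /Ctilde_lab; case: ifP; [right|left]. Qed.

Lemma A_lab34 (i : nat) : 3 = 3 \/ 3 = 4.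
Proof. by left. Qed.

Lemma all_ord_le n (e : seq 'I_n.+1) : all (fun k => k <= n) (map val e).
Proof. by apply/allP => _ /mapP[s _ ->]; rewrite -ltnS ltn_ord. Qed.

Lemma CFC_A_card n k : 0 < n ->
  #|` fset_set (CFC_of_length (A_matrix n.+1) k)| = size (uniq_classes n k).
Proof.
move=> n0; apply: (card_CFC (cls := @projections n)).
- exact: undup_uniq.
- by move=> e f; exact: (projectionsP A_lab_neq1 A_lab34 n0).
- move=> w e cfc ew ek; apply/uniq_classesP; exists e; split=> //.
  rewrite -(map_inj_uniq val_inj); apply: (@Acyc_uniq n) => r.
  have av := CFC_rot_avoids (r := r) cfc ew; rewrite -map_rot; split.
  + exact: all_ord_le.
  + exact: avoids_gap_nonempty A_lab34 _ av.
  + move=> u i x v xE ix nx.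
    have [j jx] := avoids_gap_simple A_lab34 av xE ix nx.
    by case: ifP; rewrite andbF.
- move=> v /uniq_classesP[e [ev ek ue]]; exists e.
  by have [] := uniq_CFC A_lab_neq1 A_lab34 ue.
Qed.

Lemma count_flatten_nseq (T : eqType) (a : T) p (s : seq T) :
  count_mem a (flatten (nseq p s)) = p * count_mem a s.
Proof. by elim: p => //= p IH; rewrite count_cat IH mulSn. Qed.

Lemma filter_flatten_nseq (T : Type) (P : pred T) p (s : seq T) :
  filter P (flatten (nseq p s)) = flatten (nseq p (filter P s)).
Proof. by elim: p => //= p IH; rewrite filter_cat IH. Qed.

Lemma count_alt (T : eqType) (a b : T) p : a != b ->
  count_mem a (alt a b p.*2) = p /\ count_mem b (alt a b p.*2) = p.
Proof.
move=> ab; have ba : (b == a) = false by rewrite eq_sym; apply/negbTE.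
by elim: p => [|p [IH1 IH2]] //=; rewrite IH1 IH2 !eqxx ba (negPf ab).
Qed.

Lemma alt_nosquare (T : eqType) (a b c : T) k u v : a != b ->
  alt a b k <> u ++ c :: c :: v.
Proof.
elim: u a b k => [|d u IH] a b [|k] ab //=.
  by case: k => //= k [ac bc _]; rewrite ac bc eqxx in ab.
by case=> _; apply: IH; rewrite eq_sym.
Qed.

Section Ctilde.
Variable n : nat.
Hypothesis n2 : 2 <= n.
Local Notation M := (Ctilde_matrix n).
Implicit Types (e f : seq 'I_n.+1) (E : seq nat).

Let n_gt0 : 0 < n. Proof. exact: ltnW. Qed.
Let lab34 := C_lab34 n.

Let exM : cox_exact M := @path_exact n.+1 _ (Ctilde_lab_neq1 n) lab34.

Lemma C_cyc e : (forall r, avoids M (rot r e)) -> Ccyc n (map val e).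
Proof.
move=> av r; have {}av := av r; rewrite -map_rot; split.
- exact: all_ord_le.
- exact: avoids_gap_nonempty lab34 _ av.
- exact: (@avoids_gap_simple _ _ (Ctilde_lab_neq1 n) lab34 _ av).
- have o1 : 1 < n.+1 by [].
  have on : n < n.+1 by [].
  have on1 : n.-1 < n.+1 by rewrite ltnS leq_pred.
  split.
    have := @avoids_gap_double _ _ (Ctilde_lab_neq1 n) lab34 _ (@Ordinal n.+1 0 isT) (Ordinal o1).
    apply=> // k; rewrite /adj /= => H; apply/val_inj => /=.
    by move: H; move: (nat_of_ord k); clear; lia.
  have := @avoids_gap_double _ _ (Ctilde_lab_neq1 n) lab34 _ (Ordinal on) (Ordinal on1).
  apply=> // [|k]; rewrite /adj /=.
    rewrite /path_m -val_eqE /= /Ctilde_lab eqxx orbT prednK // eqxx.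
    by rewrite (gtn_eqF (_ : n.-1 < n)) ?(gtn_eqF (_ : n.-1 < n.+1)) // prednK.
  have := ltn_ord k => kn H; apply/val_inj => /=.
  by move: kn H n_gt0; move: (nat_of_ord k); clear; lia.
Qed.

(** Unlike [alternates], this is a condition on the linear word; a commutation
    class is determined by the choice made for each [i]. *)
Definition alternating p E := forall i, i < n ->
  filter (pred2 i i.+1) E = alt i i.+1 p.*2 \/
  filter (pred2 i i.+1) E = alt i.+1 i p.*2.

Lemma alternating_rot p r E : alternating p E -> alternating p (rot r E).
Proof.
move=> aE i /aE; have [r' ->] := filter_rot_ex (pred2 i i.+1) E r.
move: (filter _ E) => s sE.
by apply: (rot_ind (P := fun s => s = alt i i.+1 p.*2 \/ s = alt i.+1 i p.*2)) => // _ [->|->];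
  rewrite rot1_alt; [right|left].
Qed.

Lemma alternating_count p E i : alternating p E -> i <= n -> count_mem i E = p.
Proof.
move=> aE i_n; pose j := if i < n then i else i.-1.
have j_n : j < n by rewrite /j; case: ifP => //; move: n2 i_n; clear; lia.
have ij : pred2 j j.+1 i by rewrite /j /=; case: ifP; move: n2 i_n; clear; lia.
have -> : count_mem i E = count_mem i (filter (pred2 j j.+1) E).
  rewrite count_filter; apply: eq_count => k /=.
  by have [->|] := eqVneq k i; [rewrite /= in ij; rewrite ij|].
have jj : j != j.+1 by rewrite neq_ltn ltnSn.
have jj' : j.+1 != j by rewrite eq_sym.
have [c1 c2] := count_alt p jj; have [c3 c4] := count_alt p jj'.
by case/orP: ij => /eqP ->; case: (aE j j_n) => ->.
Qed.

Lemma alternating_size p E : all (fun k => k <= n) E -> alternating p E ->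
  size E = p * n.+1.
Proof.
move=> En aE; rewrite (size_counts En) big_nat (eq_bigr (fun=> p)); last first.
  by move=> i; rewrite ltnS => /andP[_]; exact: alternating_count.
by rewrite -big_nat sum_nat_const_nat subn0 mulnC.
Qed.

(** Read with one of its neighbours, [s] alternates. *)
Lemma alternating_nosquare p E u s v : alternating p E -> s <= n ->
  E <> u ++ s :: s :: v.
Proof.
move=> aE s_n EE; pose j := if s < n then s else s.-1.
have j_n : j < n by rewrite /j; case: ifP => //; move: n2 s_n; clear; lia.
have ij : (s == j) || (s == j.+1) by rewrite /j /=; case: ifP; move: n2 s_n; clear; lia.
have jj : j != j.+1 by rewrite neq_ltn ltnSn.
have jj' : j.+1 != j by rewrite eq_sym.
have := aE j j_n; rewrite EE filter_cat /= ij.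
by case; apply/nesym/alt_nosquare.
Qed.

(** Reading [s] together with its neighbour other than [t], one would see [ss]. *)
Lemma alternating_nobraid p E u s t v : alternating p E -> 0 < s < n ->
  adj s t -> E <> u ++ [:: s, t, s & v].
Proof.
move=> aE s_n st EE; pose j := if t == s.+1 then s.-1 else s.
have j_n : j < n by rewrite /j; case: ifP; move: s_n; clear; lia.
have ij : (s == j) || (s == j.+1) by rewrite /j /=; case: ifP; move: s_n; clear; lia.
have tj : (t == j) || (t == j.+1) = false.
  by rewrite /j; move: st s_n; rewrite /adj; clear; case: ifP; lia.
have jj : j != j.+1 by rewrite neq_ltn ltnSn.
have jj' : j.+1 != j by rewrite eq_sym.
have := aE j j_n; rewrite EE filter_cat /= ij tj.
by case; apply/nesym/alt_nosquare.
Qed.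

(** As [n] is at least 2, an edge cannot join the two ends, so a braid always
    contains [sts] with [s] inner. *)
Lemma C_bond (s t : 'I_n.+1) : 3 <= M s t ->
  adj s t /\ ((0 < s < n /\ 0 < t < n /\ M s t = 3) \/
              (M s t = 4 /\ (0 < s < n \/ 0 < t < n))).
Proof.
have := ltn_ord s; have := ltn_ord t.
rewrite /= /path_m /Ctilde_lab /adj -val_eqE /=.
move: (nat_of_ord s) (nat_of_ord t) => a b; move: n2; clear.
repeat case: ifP; lia.
Qed.

Lemma alternating_CFC p e : alternating p (map val e) ->
  reduced_expr (cox_word M e) e /\ is_CFC (cox_word M e).
Proof.
move=> ae; suff [] : [/\ avoids M e, reduced_expr (cox_word M e) e & is_CFC (cox_word M e)] by [].
apply: (CFC_of_stable (K := fun e => alternating p (map val e)) exM) ae.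
- move=> e1 e2 /(@ceq_projections _ _ (Ctilde_lab_neq1 n) lab34)/projections_eq ef ae i i_n.
  by rewrite -ef //; exact: ae.
- by move=> r e1; rewrite map_rot; exact: alternating_rot.
- move=> u s v; rewrite map_cat /= => /alternating_nosquare H.
  by apply: (H (map val u) s (map val v)); rewrite // -ltnS ltn_ord.
- move=> u s t v mst; have [st ss] := C_bond mst.
  have ts : adj t s by move: st; rewrite /adj orbC ![_ == S _]eq_sym.
  move: mst; case: ss => [[s_n [_ ->]]|[-> [s_n|t_n]]] _;
      rewrite map_cat /= => /alternating_nobraid H.
  + exact: (H (map val u) s t (map val v)).
  + exact: (H (map val u) s t (val t :: map val v)).
  + by apply: (H (map val u ++ [:: val s]) t s (map val v)) => //; rewrite -catA.
Qed.

End Ctilde.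

(** * Zigzag words *)

Section Zigzag.
Variable n : nat.
Hypothesis n2 : 2 <= n.
Local Notation M := (Ctilde_matrix n).
Implicit Types (e f : seq 'I_n.+1) (E : seq nat).

Let n_gt0 : 0 < n. Proof. exact: ltnW. Qed.
Let lab34 := C_lab34 n.
Let exM : cox_exact M := @path_exact n.+1 _ (Ctilde_lab_neq1 n) lab34.

(** The closed form of the letters of [zigzag n]. Reasoning on positions modulo
    [2n] is the simplest way to look at short factors of its rotations. *)
Definition zig k := if k is k'.+1 then minn k' (n.*2 - k') else 1.

Lemma size_zigzag : size (zigzag n) = n.*2.
Proof. by rewrite /= size_updown; move: n2; clear; lia. Qed.

Lemma nth_zigzag k : k < n.*2 -> nth 0 (zigzag n) k = zig k.
Proof.
case: k => [|[|[|k]]] // kn; rewrite /zig /=.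
- by move: n2; clear; lia.
- by move: n2; clear; lia.
rewrite /updown nth_cat size_iota.
case: ltnP => h1; first by rewrite nth_iota //; move: h1; clear; lia.
case: (eqVneq k (n - 2)) => [e|ne].
  by rewrite e subnn /=; move: n2 e; clear; lia.
have -> : k - (n - 2) = (k - (n - 2)).-1.+1 by move: h1 ne; clear; lia.
rewrite /= nth_rev ?size_iota; last by move: n2 kn h1 ne; clear; lia.
by rewrite nth_iota; move: n2 kn h1 ne; clear; lia.
Qed.

Definition zword p r := mkseq (fun k => zig ((r + k) %% n.*2)) (p * n.*2).

Lemma size_zword p r : size (zword p r) = p * n.*2.
Proof. exact: size_mkseq. Qed.

Lemma nth_zword p r k : k < p * n.*2 -> nth 0 (zword p r) k = zig ((r + k) %% n.*2).
Proof. by move=> kp; rewrite nth_mkseq. Qed.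

Lemma zword0 p : zword p 0 = flatten (nseq p (zigzag n)).
Proof.
elim: p => [//|p IH] /=; rewrite -[_ :: _]/(zigzag n ++ _) -IH.
apply: (@eq_from_nth _ 0); rewrite ?size_cat ?size_zword ?size_zigzag ?mulSn // => k kn.
rewrite nth_zword ?mulSn // add0n nth_cat size_zigzag.
case: ltnP => h; first by rewrite modn_small // nth_zigzag.
rewrite nth_zword; last by move: kn h; clear; lia.
by rewrite add0n -{1}(subnK h) modnDr.
Qed.

Lemma rot1_zword p r : rot 1 (zword p r) = zword p r.+1.
Proof.
apply: (@eq_from_nth _ 0); rewrite ?size_rot ?size_zword // => k kn.
have p0 : 0 < p * n.*2 by exact: leq_ltn_trans kn.
rewrite /rot nth_cat size_drop size_zword nth_drop.
case: ltnP => h.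
  by rewrite !nth_zword ?addSn ?addnS ?add1n //; move: h; clear; lia.
have -> : k = (p * n.*2).-1 by move: kn h; clear; lia.
rewrite nth_take subn1 ?subnn // !nth_zword ?prednK // addn0.
by rewrite addSnnS prednK // -modnDmr modnMl addn0.
Qed.

Lemma rot_zword p r r' : exists r'', rot r' (zword p r) = zword p r''.
Proof.
apply: (rot_ind (P := fun s => exists r'', s = zword p r'')).
  by move=> _ [r'' ->]; exists r''.+1; exact: rot1_zword.
by exists r.
Qed.

Lemma count_zword a p r : count_mem a (zword p r) = p * count_mem a (zigzag n).
Proof.
rewrite -count_flatten_nseq -zword0; elim: r => [//|r IH].
by rewrite -rot1_zword count_rot.
Qed.

Lemma zigzag_count0 : count_mem 0 (zigzag n) = 1 /\ count_mem 1 (zigzag n) = 2.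
Proof.
have up a : a < 2 -> count_mem a (updown 2 n) = 0.
  move=> a2; apply/count_memPn; rewrite mem_cat inE mem_rev mem_iota; move: n2 a2.
  by clear; lia.
by rewrite /= !up.
Qed.

Lemma zig_le k : zig k <= n.
Proof. by case: k => [|k] /=; move: n2; clear; lia. Qed.

Lemma zword_modn p r : zword p r = zword p (r %% n.*2).
Proof. by apply: eq_map => k; rewrite modnDml. Qed.

(** This is why zigzag words allow no commutation. *)
Lemma zig_adj k : k < n.*2 -> adj (zig k) (zig (k.+1 %% n.*2)).
Proof.
move=> kn; have [e|ne] := eqVneq k.+1 n.*2.
  by rewrite e modnn /adj; case: k kn e => [|k] /=; move: n2; clear; lia.
rewrite modn_small; last by move: kn ne; clear; lia.
by rewrite /adj; case: k kn ne => [|k] /=; move: n2; clear; lia.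
Qed.

(** For the braids: a factor [sts] turns round at [t]. *)
Lemma zig_turn k : k < n.*2 -> zig k = zig (k.+2 %% n.*2) ->
  zig (k.+1 %% n.*2) = 0 \/ zig (k.+1 %% n.*2) = n.
Proof.
move=> kn; have [e|ne] := eqVneq k.+1 n.*2.
  have -> : k.+2 %% n.*2 = 1.
    by rewrite -[k.+2]/(1 + k.+1) e modnDr modn_small //; move: n2; clear; lia.
  by rewrite e modnn; case: k kn e => [|k] /=; move: n2; clear; lia.
rewrite [k.+1 %% _]modn_small; last by move: kn ne; clear; lia.
have [e'|ne'] := eqVneq k.+2 n.*2.
  by rewrite e' modnn; case: k kn e' ne => [|k] /=; move: n2; clear; lia.
rewrite modn_small; last by move: kn ne ne'; clear; lia.
by case: k kn ne ne' => [|k] /=; move: n2; clear; lia.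
Qed.

Lemma zword_factor p r u x v : zword p r = u ++ x ++ v ->
  exists2 k, k < n.*2 & forall j, j < size x -> nth 0 x j = zig ((k + j) %% n.*2).
Proof.
move=> zE; have n0 : 0 < n.*2 by rewrite double_gt0.
exists ((r + size u) %% n.*2); first by rewrite ltn_mod.
move=> j jx; rewrite modnDml -addnA -(@nth_zword p).
  by rewrite zE nth_cat ltnNge leq_addr /= addKn nth_cat jx.
by rewrite -(size_zword p r) zE !size_cat ltn_add2l ltn_addr.
Qed.

Definition is_zigzag p e := exists r, map val e = zword p r.

Lemma is_zigzag_step p e u (s t : 'I_n.+1) v : is_zigzag p e -> e = u ++ s :: t :: v ->
  adj s t.
Proof.
case=> r er eE; move: er; rewrite eE map_cat /= => /esym.
move=> /(@zword_factor _ _ _ [:: val s; val t])[k kn f].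
have := f 0 isT; have := f 1 isT; rewrite /= addn0 addn1 => -> ->.
by rewrite [k %% _]modn_small //; exact: zig_adj.
Qed.

Lemma is_zigzag_ceq p e f : commutation_equiv M e f -> is_zigzag p e -> e = f.
Proof.
elim=> // u v s t g mst _ IH ze.
have := is_zigzag_step ze (erefl _).
have st : s != t by apply: contra_eq_neq mst => ->; rewrite cox_diag.
by rewrite -(path_adj (Ctilde_lab_neq1 n) lab34 st) mst.
Qed.

(** A factor [sts] has an end for middle letter, which excludes bonds labelled 3;
    a factor [stst] would have an end for both middle letters. *)
Lemma zigzag_CFC p e : is_zigzag p e ->
  reduced_expr (cox_word M e) e /\ is_CFC (cox_word M e).
Proof.
move=> ze; suff [] : [/\ avoids M e, reduced_expr (cox_word M e) e & is_CFC (cox_word M e)] by [].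
apply: (CFC_of_stable (K := is_zigzag p) exM) ze.
- by move=> e1 e2 e12 z1; rewrite -(is_zigzag_ceq e12 z1).
- move=> r e1 [r1 r1E]; have [r2 r2E] := rot_zword p r1 r.
  by exists r2; rewrite map_rot r1E.
- by move=> u s v /is_zigzag_step/(_ (erefl _)); rewrite /adj; clear; lia.
- move=> u s t v mst [r]; have [st ss] := C_bond n2 mst.
  have m34 : exists k,
      alt s t (M s t) = [:: s, t, s & alt t s k] /\ (k = 0 /\ 0 < t < n \/ k = 1).
    by case: ss => [[_ [t_n ->]]|[-> _]]; [exists 0|exists 1]; split=> //; [left|right].
  case: m34 => k [-> kE]; rewrite map_cat /= => /esym.
  have val_alt : map val (alt t s k) = alt (val t) (val s) k.
    by case: kE => [[-> _]|->].
  rewrite map_cat val_alt.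
  move=> /(@zword_factor _ _ _ [:: val s, val t, val s & alt (val t) (val s) k])[a an f].
  have f0 : nat_of_ord s = zig a.
    by rewrite -[a](modn_small an) -[X in zig (X %% _)]addn0; exact: (f 0).
  have f1 : nat_of_ord t = zig (a.+1 %% n.*2) by rewrite -[a.+1]addn1; exact: (f 1).
  have f2 : nat_of_ord s = zig (a.+2 %% n.*2) by rewrite -[a.+2]addn2; exact: (f 2).
  have t_end : nat_of_ord t = 0 \/ nat_of_ord t = n.
    by rewrite f1; apply: zig_turn => //; rewrite -f0 -f2.
  case: kE => [[_ t_n]|k1]; first by move: t_end t_n; clear; lia.
  have f3 : nat_of_ord t = zig (a.+3 %% n.*2).
    by rewrite k1 in f; rewrite -[a.+3]addn3; exact: (f 3).
  have modD b c : (b %% n.*2 + c) %% n.*2 = (b + c) %% n.*2 by exact: modnDml.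
  have s_end : nat_of_ord s = 0 \/ nat_of_ord s = n.
    have e2 : (a.+1 %% n.*2).+1 %% n.*2 = a.+2 %% n.*2.
      by have := modD a.+1 1; rewrite !addn1.
    have e3 : (a.+1 %% n.*2).+2 %% n.*2 = a.+3 %% n.*2.
      by have := modD a.+1 2; rewrite !addn2.
    have := @zig_turn (a.+1 %% n.*2); rewrite ltn_mod double_gt0 => /(_ n_gt0).
    by rewrite e2 e3 -f1 -f2 -f3; apply.
  by move: st s_end t_end n2; rewrite /adj; clear; lia.
Qed.

End Zigzag.

(** * Counting the classes *)

Section Count.
Variable n : nat.
Hypothesis n2 : 2 <= n.
Local Notation M := (Ctilde_matrix n).
Implicit Types (e f : seq 'I_n.+1) (E : seq nat) (t : seq bool).

Let n_gt0 : 0 < n. Proof. exact: ltnW. Qed.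
Let lab34 := C_lab34 n.

Lemma ord_word E : all (fun k => k <= n) E -> exists e, map val e = E.
Proof.
move=> /allP En; exists [seq inord k | k <- E]; rewrite -map_comp -[RHS]map_id.
by apply/eq_in_map => k /En kn /=; rewrite inordK.
Qed.

Definition alt_projections p t : seq (seq nat) :=
  [seq if nth false t i then alt i i.+1 p.*2 else alt i.+1 i p.*2 | i <- iota 0 n].

Lemma alternatingP p e : alternating n p (map val e) <->
  exists t : n.-tuple bool, projections e = alt_projections p t.
Proof.
split=> [ae|[t /eq_in_map te] i i_n]; last first.
  have := te i; rewrite mem_iota /= => -> //.
  by case: nth; [left|right].
pose s := [seq filter (pred2 i i.+1) (map val e) == alt i i.+1 p.*2 | i <- iota 0 n].
have ss : size s == n by rewrite size_map size_iota.
exists (Tuple ss); apply/eq_in_map => i; rewrite mem_iota add0n => /andP[_ i_n].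
rewrite /= (nth_map 0) ?size_iota // nth_iota // add0n.
by case: eqP => // ne; case: (ae i i_n).
Qed.

(** A Coxeter word realizing any choice of which of [i] and [i + 1] comes first:
    the bit [t_i] tells on which side of the previous letters [i + 1] is put. *)
Fixpoint coxeter_word t k : seq nat :=
  if k is k'.+1 then
    if nth false t k' then rcons (coxeter_word t k') k else k :: coxeter_word t k'
  else [:: 0].

Lemma mem_coxeter_word t k a : (a \in coxeter_word t k) = (a <= k).
Proof.
elim: k => [|k IH] /=; first by rewrite inE leqn0.
by case: ifP => _; rewrite ?mem_rcons inE IH; clear; lia.
Qed.

Lemma filter_coxeter_word t k i : i < k ->
  filter (pred2 i i.+1) (coxeter_word t k) =
  if nth false t i then [:: i; i.+1] else [:: i.+1; i].
Proof.
have single j : filter (pred2 j j.+1) (coxeter_word t j) = [:: j].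
  have /eq_in_filter -> : {in coxeter_word t j, pred2 j j.+1 =1 pred1 j}.
    by move=> a; rewrite mem_coxeter_word /=; clear; lia.
  case: j => //= j; case: ifP => _; rewrite ?filter_rcons /= eqxx.
    rewrite (_ : filter _ _ = [::]) //; apply/eqP; rewrite -size_eq0 size_filter.
    by apply/eqP/count_memPn; rewrite mem_coxeter_word ltnn.
  rewrite (_ : filter _ _ = [::]) //; apply/eqP; rewrite -size_eq0 size_filter.
  by apply/eqP/count_memPn; rewrite mem_coxeter_word ltnn.
elim: k => // k IH; rewrite ltnS leq_eqVlt => /predU1P[->|ik] /=.
  by case: ifP => _; rewrite ?filter_rcons /= eqxx orbT single.
have kF : (k.+1 == i) || (k.+1 == i.+1) = false by move: ik; clear; lia.
by case: (nth false t k); rewrite ?filter_rcons /= kF IH.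
Qed.

Lemma alternating_ex p (t : n.-tuple bool) : exists e,
  [/\ projections e = alt_projections p t, alternating n p (map val e)
    & size e = p * n.+1].
Proof.
have [|e eE] := @ord_word (flatten (nseq p (coxeter_word t n))).
  apply/allP => k /flattenP[s /nseqP[-> _]].
  by rewrite mem_coxeter_word.
have et : projections e = alt_projections p t.
  apply/eq_in_map => i; rewrite mem_iota add0n => /andP[_ i_n].
  rewrite eE filter_flatten_nseq filter_coxeter_word //.
  by case: ifP => _; rewrite flatten_alt.
have ae : alternating n p (map val e) by apply/alternatingP; exists t.
exists e; split=> //.
by rewrite -(size_map val) (alternating_size n2 _ ae) // all_ord_le.
Qed.

Definition alternating_classes p : seq (seq (seq nat)) :=
  [seq alt_projections p (tval b) | b <- enum {: n.-tuple bool}].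

Lemma size_alternating_classes p : size (alternating_classes p) = 2 ^ n.
Proof. by rewrite size_map -cardE card_tuple card_bool. Qed.

Lemma alternating_classesP p e :
  reflect (alternating n p (map val e)) (projections e \in alternating_classes p).
Proof.
apply: (iffP mapP) => [[t _ et]|/alternatingP[t et]].
  by apply/alternatingP; exists t.
by exists t; rewrite ?mem_enum.
Qed.

Lemma alternating_classes_uniq p : 0 < p -> uniq (alternating_classes p).
Proof.
move=> p0; rewrite map_inj_uniq ?enum_uniq // => t1 t2 /eq_in_map t12.
apply: eq_from_tnth => i; rewrite !(tnth_nth false).
have := t12 i; rewrite mem_iota add0n ltn_ord => /(_ isT).
case: p p0 {t12} => // p _; rewrite doubleS.
by case: (nth _ t1 i); case: (nth _ t2 i) => //= -[] /eqP; clear; lia.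
Qed.

Definition zigzag_classes p : seq (seq (seq nat)) :=
  [seq [seq filter (pred2 i i.+1) (zword n p r) | i <- iota 0 n] | r <- iota 0 n.*2].

Lemma zigzag_ex p r : exists e, map val e = zword n p r.
Proof.
by apply: ord_word; apply/allP => _ /mapP[k _ ->]; exact: zig_le.
Qed.

Lemma zigzag_classesP p e : projections e \in zigzag_classes p <-> is_zigzag p e.
Proof.
split=> [/mapP[r _]|[r er]].
  have [f fr] := zigzag_ex p r; rewrite -fr => ef.
  have fe := projections_ceq (Ctilde_lab_neq1 n) lab34 n_gt0 (esym ef).
  have zf : is_zigzag p f by exists r.
  by rewrite -(is_zigzag_ceq n2 fe zf).
apply/mapP; exists (r %% n.*2); first by rewrite mem_iota ltn_mod double_gt0.
by rewrite -zword_modn // -er.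
Qed.

(** Two letters are needed, as each inner letter is met once on the way up and
    once on the way down. *)
Lemma zig_inj a b : a < n.*2 -> b < n.*2 -> zig n a = zig n b ->
  zig n (a.+1 %% n.*2) = zig n (b.+1 %% n.*2) -> a = b.
Proof.
have E k : k < n.*2 -> k.+1 %% n.*2 = if k.+1 == n.*2 then 0 else k.+1.
  by move=> kn; case: eqP => [->|ne]; rewrite ?modnn ?modn_small //; move: kn ne; clear; lia.
move=> an bn; rewrite !E //; case: a an => [|a] an; case: b bn => [|b] bn //=; move: n2 an bn; clear;
  repeat case: eqP => /=; lia.
Qed.

Lemma zword_inj p a b : 0 < p -> a < n.*2 -> b < n.*2 ->
  zword n p a = zword n p b -> a = b.
Proof.
move=> p0 an bn ab; have len : 1 < p * n.*2 by move: n2 p0; clear; nia.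
apply: zig_inj => //.
  have := congr1 (nth 0 ^~ 0) ab; rewrite /= !nth_zword ?(ltnW len) //.
  by rewrite !addn0 !modn_small.
by have := congr1 (nth 0 ^~ 1) ab; rewrite /= !nth_zword // !addn1.
Qed.

Lemma zigzag_classes_uniq p : 0 < p -> uniq (zigzag_classes p).
Proof.
move=> p0; rewrite map_inj_in_uniq ?iota_uniq // => a b.
rewrite !mem_iota !add0n => /andP[_ an] /andP[_ bn].
have [e ea] := zigzag_ex p a; have [f fb] := zigzag_ex p b.
rewrite -ea -fb => /(projections_ceq (Ctilde_lab_neq1 n) lab34 n_gt0) ef.
have ze : is_zigzag p e by exists a.
by apply: (zword_inj p0) => //; rewrite -ea -fb (is_zigzag_ceq n2 ef ze).
Qed.

Lemma size_zigzag_classes p : size (zigzag_classes p) = n.*2.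
Proof. by rewrite size_map size_iota. Qed.

Lemma zigzag_counts p e : is_zigzag p e ->
  count_mem 0 (map val e) = p /\ count_mem 1 (map val e) = p.*2.
Proof.
case=> r ->; rewrite !count_zword //; have [-> ->] := zigzag_count0 n2.
by rewrite muln1 muln2.
Qed.

Definition alternating_length k := (n.+1 %| k) && (2 * n.+1 <= k).
Definition zigzag_length k := (n.*2 %| k) && (n.*2 <= k).

Definition C_classes k : seq (seq (seq nat)) :=
  uniq_classes n k ++
  (if alternating_length k then alternating_classes (k %/ n.+1) else [::]) ++
  (if zigzag_length k then zigzag_classes (k %/ n.*2) else [::]).

Lemma alternating_length_gt1 k : alternating_length k -> 1 < k %/ n.+1.
Proof. by case/andP=> _ le; rewrite leq_divRL. Qed.

Lemma zigzag_length_gt0 k : zigzag_length k -> 0 < k %/ n.*2.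
Proof. by case/andP=> _ le; rewrite divn_gt0 // double_gt0. Qed.

Lemma C_classes_uniq k : uniq (C_classes k).
Proof.
rewrite /C_classes cat_uniq undup_uniq /= cat_uniq.
(* 0 and 1 are equally frequent in alternating words, but not in zigzags *)
have BZ : forall e p q, 0 < p -> alternating n p (map val e) -> is_zigzag q e -> False.
  move=> e p q p0 ae ze; have [c0 c1] := zigzag_counts ze.
  have := alternating_count n2 ae (leq0n n); have := alternating_count n2 ae n_gt0.
  by rewrite c0 c1; move: p0; clear; lia.
have U1 e a : uniq e -> count_mem a (map val e) <= 1.
  by move=> ue; rewrite count_uniq_mem ?leq_b1 // map_inj_uniq //; exact: val_inj.
apply/and4P; split.
- apply/hasPn => v; rewrite mem_cat; case/orP; case: ifP => // kP vP.
    case/mapP: vP => t _ ->; apply/negP => /uniq_classesP[e [et _ ue]].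
    have ae : alternating n (k %/ n.+1) (map val e) by apply/alternatingP; exists t.
    have := U1 e 0 ue; rewrite (alternating_count n2 ae) //.
    by rewrite leqNgt alternating_length_gt1.
  apply/negP => /uniq_classesP[e [et _ ue]].
  rewrite -et in vP; have /zigzag_classesP ze := vP.
  have [_ c1] := zigzag_counts ze; have := U1 e 1 ue; rewrite c1.
  by have := zigzag_length_gt0 kP; clear; lia.
- by case: ifP => // /alternating_length_gt1 p1; apply: alternating_classes_uniq; exact: ltnW.
- apply/hasPn => v; case: ifP => // kZ vZ; case: ifP => // kB.
  apply/negP; case/mapP=> t _ vt; have [e [et ae _]] := alternating_ex (k %/ n.+1) t.
  move: vZ; rewrite vt -et => /zigzag_classesP; apply: BZ ae.
  exact: ltnW (alternating_length_gt1 kB).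
- by case: ifP => // /zigzag_length_gt0; exact: zigzag_classes_uniq.
Qed.

Lemma CFC_C_card k :
  #|` fset_set (CFC_of_length (Ctilde_matrix n) k)| = size (C_classes k).
Proof.
apply: (card_CFC (cls := @projections n)).
- exact: C_classes_uniq.
- by move=> e f; exact: (projectionsP (Ctilde_lab_neq1 n) lab34 n_gt0).
- move=> w e cfc ew ek; rewrite !mem_cat.
  have cE : Ccyc n (map val e) by apply: C_cyc => // r; exact: CFC_rot_avoids cfc ew.
  have sz : size (map val e) = k by rewrite size_map.
  case: (Ccyc_classification n2 cE) => [ue|[p p1 alt_e]|[p [r [p0 er]]]].
  + apply/orP; left; apply/uniq_classesP; exists e; split=> //.
    by rewrite -(map_inj_uniq val_inj).
  + have ae : alternating n p (map val e) by move=> i /alt_e/alternates_linear.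
    have kE : k = p * n.+1 by rewrite -sz (alternating_size n2 _ ae) // all_ord_le.
    have -> : alternating_length k by rewrite /alternating_length kE dvdn_mull //= leq_pmul2r.
    by rewrite kE mulnK // (introT (alternating_classesP _ _) ae) orbT.
  + have ze : is_zigzag p e.
      by rewrite -zword0 // in er; have [r' rE] := rot_zword n p 0 r; exists r'; rewrite er.
    have kE : k = p * n.*2.
      by case: ze => r' er'; rewrite -sz er' size_zword.
    have -> : zigzag_length k by rewrite /zigzag_length kE dvdn_mull //= leq_pmull.
    rewrite kE mulnK ?double_gt0 //; have /zigzag_classesP -> := ze.
    by rewrite !orbT.
- move=> v; rewrite !mem_cat => /or3P[].
  + case/uniq_classesP=> e [ev ek ue]; exists e.
    by have [] := uniq_CFC (Ctilde_lab_neq1 n) lab34 ue.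
  + case: ifP => // kB /mapP[t _ ->]; have [e [et ae se]] := alternating_ex (k %/ n.+1) t.
    exists e; have [] := alternating_CFC n2 ae.
    by rewrite se divnK //; case/andP: kB.
  + case: ifP => // kZ /mapP[r _ ->]; have [e er] := zigzag_ex (k %/ n.*2) r.
    have ze : is_zigzag (k %/ n.*2) e by exists r.
    exists e; have [] := zigzag_CFC n2 ze; split=> //; first by rewrite /projections er.
    by rewrite -(size_map val) er size_zword divnK //; case/andP: kZ.
Qed.

Lemma size_C_classes k : size (C_classes k) = size (uniq_classes n k) +
  ((if alternating_length k then 2 ^ n else 0) + (if zigzag_length k then 2 * n else 0)).
Proof.
rewrite !size_cat; congr (_ + (_ + _)); case: ifP => // _.
  exact: size_alternating_classes.
by rewrite size_zigzag_classes mul2n.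
Qed.

Lemma uniq_classes_gt k : n.+1 < k -> size (uniq_classes n k) = 0.
Proof.
move=> kn; apply/eqP; rewrite size_eq0; apply/eqP.
case E: (uniq_classes n k) => [//|v s].
have /uniq_classesP[e [_ ek /card_uniqP ue]] : v \in uniq_classes n k by rewrite E mem_head.
by have := max_card (mem e); rewrite ue card_ord ek leqNgt kn.
Qed.

(** A word without repetition that uses every letter reads each edge once. *)
Lemma uniq_classes_full : size (uniq_classes n n.+1) = 2 ^ n.
Proof.
rewrite -(size_alternating_classes 1); apply/perm_size/uniq_perm.
- exact: undup_uniq.
- exact: alternating_classes_uniq.
move=> v; apply/uniq_classesP/idP => [[e [<- sz ue]]|/mapP[t _ ->]].
  apply/alternating_classesP => i i_n.
  have all_e : mem e =i predT.
    apply/subset_cardP; last exact: subset_predT.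
    by rewrite (card_uniqP ue) sz card_ord.
  have uF : uniq (filter (pred2 i i.+1) (map val e)).
    by rewrite filter_uniq // map_inj_uniq //; exact: val_inj.
  have : perm_eq (filter (pred2 i i.+1) (map val e)) [:: i; i.+1].
    apply: uniq_perm => // [|a]; first by rewrite /= inE neq_ltn ltnSn.
    rewrite mem_filter /= !inE; have [/= ia|//] := boolP (_ || _).
    have an : a < n.+1 by move: ia i_n; clear; lia.
    by apply/mapP; exists (Ordinal an); rewrite ?(all_e (Ordinal an)).
  move=> pF; case: (filter _ _) uF (perm_size pF) (perm_mem pF) => [|a [|b []]] //=.
  rewrite andbT inE => ab _ mF; have := mF a; have := mF b.
  rewrite !inE !eqxx orbT => /esym/orP bE /esym/orP aE.
  by case: aE bE ab => /eqP-> [] /eqP->; rewrite ?eqxx //; [left|right].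
have [e [et ae se]] := alternating_ex 1 t; exists e; split=> //; first by rewrite mul1n in se.
rewrite -(map_inj_uniq val_inj); apply: leq_count_uniq => a.
have [an|na] := leqP a n; first by rewrite (alternating_count n2 ae).
rewrite (count_memPn _) //; apply/negP => /mapP[s _ sa].
by have := ltn_ord s; rewrite -[nat_of_ord s]sa ltnS leqNgt na.
Qed.

(** Witnessed by the word [0 1 ... n - 1]. *)
Lemma uniq_classes_n : 0 < size (uniq_classes n n).
Proof.
have [|e eE] := @ord_word (iota 0 n).
  by apply/allP => k; rewrite mem_iota => /andP[_ /ltnW].
have : projections e \in uniq_classes n n.
  apply/uniq_classesP; exists e; split=> //.
    by rewrite -(size_map val) eE size_iota.
  by rewrite -(map_inj_uniq val_inj) eE iota_uniq.
by case: uniq_classes.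
Qed.

End Count.

(** * Power series and periodicity *)

Section Series.
Import GRing.Theory.
Local Open Scope ring_scope.
Implicit Types (f g : {fps int}) (k d c : nat).

Lemma fcoefD f g k : fcoef (f + g) k = fcoef f k + fcoef g k.
Proof. by []. Qed.

Lemma fcoef_mulXn f d k :
  fcoef (f * 'q ^+ d) k = if (k < d)%N then 0 else fcoef f (k - d).
Proof.
have mulX g j : fcoef (g * 'q) j = if j is j'.+1 then fcoef g j' else 0.
  rewrite mulrC; case: j => [|j].
    by rewrite [LHS]/= big_ord_recl big_ord0 mul0r addr0.
  rewrite [LHS]/= big_ord_recl /= mul0r add0r big_ord_recl /= mul1r subSS subn0.
  by rewrite big1 ?addr0 // => i _; rewrite mul0r.
elim: d k => [|d IH] k; first by rewrite expr0 mulr1 subn0.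
by rewrite exprSr mulrA mulX; case: k => // k; rewrite IH ltnS subSS.
Qed.

Definition geometric d : {fps int} := Fps (fun k => (d %| k)%N%:R).

Lemma inv_geometric d : (0 < d)%N -> (1 - 'q ^+ d)^-1 = geometric d.
Proof.
move=> d0; apply: mulr1_eq; rewrite mulrC mulrBr mulr1; apply: fpsP => k.
have -> : fcoef (geometric d - geometric d * 'q ^+ d) k =
  fcoef (geometric d) k - fcoef (geometric d * 'q ^+ d) k by [].
rewrite fcoef_mulXn /=; case: ltnP => kd.
  by rewrite subr0; case: k kd => [|k] kd; rewrite ?dvdn0 ?gtnNdvd.
rewrite -{1}(subnK kd) dvdn_addl // subrr; case: k kd => // kd.
by move: d0; rewrite ltnNge kd.
Qed.

Lemma fcoef_natr_mul c f k : fcoef (c%:R * f) k = c%:R * fcoef f k.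
Proof.
rewrite !mulr_natl; elim: c => [|c IH]; first by rewrite !mulr0n.
by rewrite !mulrS -IH.
Qed.

Lemma fcoef_geometric_term c d e k : (0 < d)%N -> (d %| e)%N ->
  fcoef (c%:R / (1 - 'q ^+ d) * 'q ^+ e) k =
  (if (d %| k) && (e <= k) then c else 0)%N%:R.
Proof.
move=> d0 de; rewrite fcoef_mulXn inv_geometric // fcoef_natr_mul /=.
case: ltnP => ek; first by rewrite andbF.
by rewrite dvdn_subl // andbT; case: ifP => _; rewrite ?mulr1 ?mulr0.
Qed.

End Series.

Local Open Scope ring_scope.

Theorem corollary3p2 (n : nat) (hn : (2 <= n)%N) :
  let C := CFC_series (Ctilde_matrix n) in
  let N := (if odd n then n * n.+1 else 2 * n * n.+1)%N in
  [/\ C = CFC_series (A_matrix n.+1)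
          + (2 ^ n)%N%:R / (1 - 'q ^+ n.+1) * 'q ^+ (2 * n.+1)
          + (2 * n)%N%:R / (1 - 'q ^+ (2 * n)) * 'q ^+ (2 * n),
      exactly_ult_periodic (fcoef C) N
    & periodicity_starts_at (fcoef C) N n.+1].
Proof.
move=> C N; have n0 : (0 < n)%N by exact: ltnW.
have size_C k : size (C_classes n k) = (size (uniq_classes n k) +
    ((if alternating_length n k then 2 ^ n else 0) + (if zigzag_length n k then 2 * n else 0)))%N.
  exact: size_C_classes.
have coefC k : fcoef C k = (size (C_classes n k))%:Z by rewrite /= CFC_C_card.
(* the coefficients beyond [n] *)
pose b k := ((if n.+1 %| k then 2 ^ n else 0) + (if 2 * n %| k then 2 * n else 0))%N.
have tail k : (n < k)%N -> fcoef C k = (b k)%:Z.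
  move=> nk; rewrite coefC size_C /b /alternating_length /zigzag_length -mul2n; congr Posz.
  have -> : ((2 * n %| k) && (2 * n <= k) = (2 * n %| k))%N.
    by have [dk|//] := boolP (_ %| k)%N; rewrite dvdn_leq //; exact: leq_ltn_trans nk.
  have [kn|kn] := eqVneq k n.+1.
    by rewrite kn dvdnn uniq_classes_full // leqNgt ltn_Pmull //= addnA addn0.
  have n1k : (n.+1 < k)%N by rewrite ltn_neqAle eq_sym kn.
  rewrite uniq_classes_gt // add0n; congr (_ + _)%N.
  have [/dvdnP[c kE]|//] := boolP (n.+1 %| k)%N.
  by rewrite kE leq_pmul2r // ltnNge; case: c kE n1k => [|[|c]] // ->; rewrite ?mul0n ?mul1n ?ltnn.
(* [N] is the least common multiple of [n + 1] and [2n] *)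
have N_B : (n.+1 %| N)%N by rewrite /N; case: ifP => _; rewrite dvdn_mull.
have N_Z : (2 * n %| N)%N.
  rewrite /N; case: ifP => on; last by rewrite dvdn_mulr.
  by rewrite mulnC dvdn_mul // dvdn2 /= on.
have N_min k : (n.+1 %| k)%N -> (2 * n %| k)%N -> (N %| k)%N.
  move=> kB kZ; rewrite /N; case: ifP => on.
    rewrite Gauss_dvd ?coprimenS // kB andbT; apply: dvdn_trans kZ.
    exact: dvdn_mull.
  rewrite Gauss_dvd ?kB ?kZ // coprimeMl coprimenS andbT.
  by rewrite coprime2n /= on.
have N0 : (0 < N)%N by rewrite /N; case: ifP => _; rewrite ?muln_gt0 ?n0.
have per_b k : b (k + N)%N = b k by rewrite /b !dvdn_addl.
have perC : periodic_from (fcoef C) N n.+1.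
  move=> k nk; rewrite !tail ?per_b //; exact: ltn_addr.
split.
- apply: fpsP => k; rewrite !fcoefD !fcoef_geometric_term ?muln_gt0 ?n0 ?dvdnn ?dvdn_mull //.
  rewrite coefC size_C !PoszD GRing.addrA /alternating_length /zigzag_length -mul2n.
  by rewrite /= CFC_A_card // !natz.
- split; first by split=> //; exists n.+1.
  move=> m [m0 [L perL]]; apply: dvdn_leq => //.
  (* a multiple of [N] beyond all thresholds, where the maximum is attained *)
  pose k := ((L + n.+1) * N)%N.
  have kL : (L <= k)%N by rewrite /k (leq_trans (leq_addr n.+1 L)) // leq_pmulr.
  have kn : (n < k)%N by rewrite /k (leq_trans (leq_addl L n.+1)) // leq_pmulr.
  have := perL k kL; rewrite !tail ?ltn_addr // => -[].
  have kB : (n.+1 %| k)%N by rewrite dvdn_mull.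
  have kZ : (2 * n %| k)%N by rewrite dvdn_mull.
  rewrite /b !(dvdn_addr, kB, kZ) //.
  have P2 : (0 < 2 ^ n)%N by rewrite expn_gt0.
  have [mB|_] := boolP (n.+1 %| m)%N; have [mZ|_] := boolP (2 * n %| m)%N.
  + by move=> _; exact: N_min.
  + by move=> e; exfalso; move: e P2 n0; clear; lia.
  + by move=> e; exfalso; move: e P2 n0; clear; lia.
  + by move=> e; exfalso; move: e P2 n0; clear; lia.
(* at length [n] there are words without repetition, but not at [n + N] *)
split=> // L perL; rewrite leqNgt; apply/negP; rewrite ltnS => Ln.
have := perL n Ln; rewrite tail ?coefC ?size_C; last by rewrite -addn1 leq_add2l.
have nB : (n.+1 %| n)%N = false by rewrite gtnNdvd.
have nZ : (2 * n %| n)%N = false by rewrite gtnNdvd // mul2n -addnn -addn1 leq_add2l.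
rewrite per_b /b nB nZ => -[/esym/eqP]; rewrite addn_eq0 => /andP[/eqP u0 _].
by have := uniq_classes_n n; rewrite u0.
Qed.
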